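(* Suppose that the following two hypotheses hold: (i) the conductivity tensor is positive definite: $k_m\xi_i\xi_i\le k_{ij}\xi_i\xi_j\le k_M\xi_i\xi_i$ for all $\xi\in\mathbb{R}^3$, where $k_m(\mathbf{x})>0$ and $k_M(\mathbf{x})$ are the lowest and the greatest eigenvalues of $k_{ij}(\mathbf{x})$; (ii) the delay times satisfy either $0\le \frac12\tau_q\le\tau_T$ or $0<\tau_T<\frac12\tau_q$. Suppose moreover that at least one of the following two hypotheses is fulfilled: (iii) $a\neq 0$; (iv) $\operatorname{meas}\Sigma_1\neq 0$. Then the initial boundary value problem $\mathcal{P}$ has at most one solution.
   Context: Summation over repeated indices is used, indices range over $\{1,2,3\}$, and a comma followed by $i$ denotes $\partial/\partial x_i$. $B\subset\mathbb{R}^3$ is a regular region (a bounded domain to which the divergence theorem applies) with closure $\overline B$, boundary $\partial B$ and outward unit normal $n_i$. $\Sigma_1,\Sigma_2\subset\partial B$ satisfy $\overline\Sigma_1\cup\Sigma_2=\partial B$ and $\Sigma_1\cap\Sigma_2=\emptyset$. The coefficients $a(\mathbf{x})$, $\varrho(\mathbf{x})$ and the symmetric tensor $k_{ij}(\mathbf{x})$ are given, time-independent, and sufficiently regular on $\overline B$; the constants $\tau_q\ge0$, $\tau_T\ge0$ are the delay times. The condition $a\neq0$ means $a(\mathbf{x})\neq 0$ at every point. Problem $\mathcal{P}$: given smooth data $\mathcal{D}=\{r;T^0,q_i^0,\dot q_i^0;\vartheta,\xi\}$, find $\mathcal{S}=\{T,q_i\}$ on $\overline B\times[0,\infty)$ such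 that on $B\times(0,\infty)$ $$q_i+\tau_q\frac{\partial q_i}{\partial t}+\frac12\tau_q^2\frac{\partial^2 q_i}{\partial t^2}=-k_{ij}T_{,j}-\tau_T k_{ij}\frac{\partial T_{,j}}{\partial t},\qquad -q_{i,i}+\varrho r=a\frac{\partial T}{\partial t},$$ with initial conditions $T(\mathbf{x},0)=T^0(\mathbf{x})$, $q_i(\mathbf{x},0)=q_i^0(\mathbf{x})$, $\frac{\partial q_i}{\partial t}(\mathbf{x},0)=\dot q_i^0(\mathbf{x})$ on $\overline B$, and boundary conditions $T=\vartheta$ on $\overline\Sigma_1\times[0,\infty)$, $q_in_i=\xi$ on $\Sigma_2\times[0,\infty)$. A solution is a pair $\{T,q_i\}$ defined on $\overline B\times[0,\infty)$ with $T\in C^{1,1}(B\times(0,\infty))$ and $q_i\in C^{1,2}(B\times(0,\infty))$ (the first superscript refers to space derivatives, the second to time derivatives, the mixed derivatives appearing in the equations being included), satisfying the equations, initial and boundary conditions. Solutions are classical: the fields and the derivatives occurring in the equations and conditions are assumed regular enough up to $\partial B$ and $t=0$ for the conditions to be meaningful and the divergence theorem to be applicable. *)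

(* Defs.v *)
From HB Require Import structures.
From mathcomp Require Import all_boot all_order all_algebra.
From mathcomp Require Import all_classical all_reals all_analysis.

Set Implicit Arguments.
Unset Strict Implicit.
Unset Printing Implicit Defensive.

Import Order.TTheory GRing.Theory Num.Theory.
Import numFieldNormedType.Exports.

Local Open Scope classical_set_scope.
Local Open Scope ring_scope.

Section Euclid.
Context {R : realType}.
Implicit Types (u v x y : 'rV[R]_3) (A B : set 'rV[R]_3).

Definition dot u v : R := \sum_(i < 3) u 0 i * v 0 i.

(* The library norm of 'rV[R]_3 is the sup norm (same topology, same bounded
   sets); lengths and diameters below are Euclidean. *)
Definition enorm u : R := Num.sqrt (dot u u).

Definition basis (i : 'I_3) : 'rV[R]_3 := delta_mx 0 i.

Definition boundary A : set 'rV[R]_3 := closure A `\` interior A.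

Definition dx (i : 'I_3) (f : 'rV[R]_3 -> R) x : R := 'D_(basis i) f x.

Definition divergence (F : 'rV[R]_3 -> 'rV[R]_3) x : R :=
  \sum_(i < 3) dx i (fun y => F y 0 i) x.

(* Two-dimensional Hausdorff measure, normalised by pi/4 so that it is the
   surface area.  In a covering (U n), d n is an upper bound of the Euclidean
   diameter of U n; the infimum is the same as with d n the diameter. *)
Definition hausdorff2_delta (delta : R) A : \bar R :=
  ereal_inf [set s : \bar R | exists (U : nat -> set 'rV[R]_3) (d : nat -> R),
    [/\ A `<=` \bigcup_n U n,
        forall n, 0 <= d n <= delta,
        forall n x y, U n x -> U n y -> enorm (x - y) <= d n
      & s = (\sum_(0 <= n <oo) (pi / 4%:R * d n ^+ 2)%:E)%E]].

Definition area A : \bar R :=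
  ereal_sup [set hausdorff2_delta delta A | delta in [set delta : R | 0 < delta]].

(* v is the outward unit normal of B at x: near x, B fills the tangent
   half-space (y - x).v < 0 and misses the opposite one, up to cones of
   arbitrarily small opening around the tangent plane.  Such a v is unique;
   there is none at an edge, a corner or a crack. *)
Definition is_outward_normal B x v : Prop :=
  enorm v = 1 /\
  forall e : R, 0 < e -> \forall y \near x,
    (dot (y - x) v < - (e * enorm (y - x)) -> B y) /\
    (e * enorm (y - x) < dot (y - x) v -> ~ closure B y).

Definition normal_part B : set 'rV[R]_3 :=
  [set x | boundary B x /\ exists v, is_outward_normal B x v].

(* Meaningful on normal_part B only. *)
Definition outward_normal B x : 'rV[R]_3 := xget 0 [set v | is_outward_normal B x v].

(* f is of class C^1 in B, and f and its first partial derivatives are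
   continuous up to the boundary. *)
Definition C1_closure B (f : 'rV[R]_3 -> R) : Prop :=
  {within closure B, continuous f} /\
  forall i, (forall x, B x -> derivable f x (basis i)) /\
    exists g : 'rV[R]_3 -> R, {within closure B, continuous g} /\
      forall x, B x -> dx i f x = g x.

(* Integrals over subsets of R^3 are computed on R * R * R, whose product
   sigma-algebra is the Borel sigma-algebra of R^3. *)
Local Notation R3 :=
  (measurableTypeR R * measurableTypeR R * measurableTypeR R)%type.

Definition of_R3 (p : R3) : 'rV[R]_3 :=
  \row_(i < 3) nth 0 [:: p.1.1 : R; p.1.2 : R; p.2 : R] i.

Definition volume_integral B (f : 'rV[R]_3 -> R) : R :=
  Rintegral ((lebesgue_measure \x lebesgue_measure) \x lebesgue_measure)%E
    (of_R3 @^-1` B) (f \o of_R3).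

(* sigma is the surface area of the boundary of B, as a Borel measure; the
   first condition determines it. *)
Definition divergence_theorem B : Prop :=
  exists sigma : {measure set R3 -> \bar R},
    (forall A : set R3, measurable A ->
       sigma A = area (boundary B `&` of_R3 @` A)) /\
    forall F : 'rV[R]_3 -> 'rV[R]_3,
      (forall i, C1_closure B (fun x => F x 0 i)) ->
      volume_integral B (divergence F) =
      Rintegral sigma (of_R3 @^-1` normal_part B)
        ((fun x => dot (F x) (outward_normal B x)) \o of_R3).

Record regular_region B : Prop := RegularRegion {
  region_nonempty : B !=set0;
  region_open : open B;
  region_connected : connected B;
  region_bounded : bounded_set B;
  region_area_finite : (area (boundary B) < +oo)%E;
  region_normal_ae : area (boundary B `\` normal_part B) = 0%E;
  region_divergence : divergence_theorem B }.

End Euclid.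

Section Problem.
Context {R : realType}.
Implicit Types (B : set 'rV[R]_3) (u T : 'rV[R]_3 -> R -> R)
  (q : 'rV[R]_3 -> R -> 'rV[R]_3).

Record boundary_decomposition B (S1 S2 : set 'rV[R]_3) : Prop := BoundaryDecomposition {
  decomp_sub1 : S1 `<=` boundary B;
  decomp_sub2 : S2 `<=` boundary B;
  decomp_cover : closure S1 `|` S2 = boundary B;
  decomp_disjoint : S1 `&` S2 = set0 }.

Definition lowest_eigenvalue (A : 'M[R]_3) (l : R) : Prop :=
  eigenvalue A l /\ forall l', eigenvalue A l' -> l <= l'.

Definition greatest_eigenvalue (A : 'M[R]_3) (l : R) : Prop :=
  eigenvalue A l /\ forall l', eigenvalue A l' -> l' <= l.

Definition quadratic_form (A : 'M[R]_3) (v : 'rV[R]_3) : R :=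
  \sum_(i < 3) \sum_(j < 3) A i j * v 0 i * v 0 j.

Definition continuous_on (X : set 'rV[R]_3) (I : set R) u : Prop :=
  {within X `*` I, continuous (fun z : 'rV[R]_3 * R => u z.1 z.2)}.

(* u, meaningful on B x (0, oo), extends continuously to the closure of B times
   [0, oo); in particular it is continuous on B x (0, oo). *)
Definition continuous_up_to_boundary B u : Prop :=
  exists v : 'rV[R]_3 -> R -> R,
    continuous_on (closure B) `[0, +oo[ v /\
    forall x t, B x -> 0 < t -> u x t = v x t.

Definition Dt u : 'rV[R]_3 -> R -> R := fun x t => derive1 (u x) t.

Definition Dx (i : 'I_3) u : 'rV[R]_3 -> R -> R := fun x t => dx i (u ^~ t) x.

Definition Dt_exists B u : Prop :=
  forall x t, B x -> 0 < t -> derivable (u x) t 1.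

Definition Dx_exists B u : Prop :=
  forall i x t, B x -> 0 < t -> derivable (u ^~ t) x (basis i).

Record temperature_regular B T : Prop := TemperatureRegular {
  temp_cont : continuous_on (closure B) `[0, +oo[ T;
  temp_Dt : Dt_exists B T;
  temp_Dx : Dx_exists B T;
  temp_DtDx : forall j, Dt_exists B (Dx j T);
  temp_Dt_cont : continuous_up_to_boundary B (Dt T);
  temp_Dx_cont : forall j, continuous_up_to_boundary B (Dx j T);
  temp_DtDx_cont : forall j, continuous_up_to_boundary B (Dt (Dx j T)) }.

Record flux_component_regular B u : Prop := FluxComponentRegular {
  flux_cont : continuous_on (closure B) `[0, +oo[ u;
  flux_Dx : Dx_exists B u;
  flux_Dt : Dt_exists B u;
  flux_Dtt : Dt_exists B (Dt u);
  flux_Dx_cont : forall j, continuous_up_to_boundary B (Dx j u);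
  flux_Dt_cont : continuous_up_to_boundary B (Dt u);
  flux_Dtt_cont : continuous_up_to_boundary B (Dt (Dt u)) }.

Record data : Type := Data {
  heat_source : 'rV[R]_3 -> R -> R;
  temp_init : 'rV[R]_3 -> R;
  flux_init : 'rV[R]_3 -> 'rV[R]_3;
  flux_rate_init : 'rV[R]_3 -> 'rV[R]_3;
  temp_boundary : 'rV[R]_3 -> R -> R;
  flux_boundary : 'rV[R]_3 -> R -> R }.

(* Continuity is the only smoothness of the data that is asked for. *)
Record data_regular B (S1 S2 : set 'rV[R]_3) (D : data) : Prop := DataRegular {
  source_cont : continuous_on (closure B) `[0, +oo[ (heat_source D);
  temp_init_cont : {within closure B, continuous (temp_init D)};
  flux_init_cont : {within closure B, continuous (flux_init D)};
  flux_rate_init_cont : {within closure B, continuous (flux_rate_init D)};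
  temp_boundary_cont :
    continuous_on (closure S1) `[0, +oo[ (temp_boundary D);
  flux_boundary_cont :
    continuous_on (S2 `&` normal_part B) `[0, +oo[ (flux_boundary D) }.

Definition flux_comp q (i : 'I_3) : 'rV[R]_3 -> R -> R := fun x t => q x t 0 i.

Record is_solution B (S1 S2 : set 'rV[R]_3) (a rho : 'rV[R]_3 -> R) (k : 'rV[R]_3 -> 'M[R]_3)
    (tau_q tau_T : R) (D : data) T q : Prop := IsSolution {
  sol_temp_regular : temperature_regular B T;
  sol_flux_regular : forall i, flux_component_regular B (flux_comp q i);
  sol_constitutive : forall i x t, B x -> 0 < t ->
    flux_comp q i x t + tau_q * Dt (flux_comp q i) x t
      + 2%:R^-1 * tau_q ^+ 2 * Dt (Dt (flux_comp q i)) x t =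
    - (\sum_(j < 3) k x i j * Dx j T x t)
      - tau_T * \sum_(j < 3) k x i j * Dt (Dx j T) x t;
  sol_energy : forall x t, B x -> 0 < t ->
    - (\sum_(i < 3) Dx i (flux_comp q i) x t) + rho x * heat_source D x t =
    a x * Dt T x t;
  sol_temp_init : forall x, closure B x -> T x 0 = temp_init D x;
  sol_flux_init : forall x, closure B x -> q x 0 = flux_init D x;
  (* the time derivative at t = 0 is one-sided *)
  sol_flux_rate_init : forall x i, closure B x ->
    h^-1 * (flux_comp q i x h - flux_comp q i x 0) @[h --> 0^'+]
      --> flux_rate_init D x 0 i;
  sol_temp_boundary : forall x t, closure S1 x -> 0 <= t ->
    T x t = temp_boundary D x t;
  (* at the points of S2 where the boundary has a normal *)
  sol_flux_boundary : forall x t, (S2 `&` normal_part B) x -> 0 <= t ->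
    dot (q x t) (outward_normal B x) = flux_boundary D x t }.

End Problem.

Arguments data R : clear implicits.

(* Main.v *)
Require Import Defs.
From HB Require Import structures.
From mathcomp Require Import all_boot all_order all_algebra.
From mathcomp Require Import all_classical all_reals all_analysis.
From mathcomp Require Import ring lra.

Set Implicit Arguments.
Unset Strict Implicit.
Unset Printing Implicit Defensive.

Import Order.TTheory GRing.Theory Num.Theory.
Import numFieldNormedType.Exports.

Local Open Scope classical_set_scope.
Local Open Scope ring_scope.

(** The difference {T, q} of two solutions solves the problem with null data.
    The coefficient a may have any sign, so that no energy controls {T, q};
    instead of one time the proof uses two, in the manner of the Lagrange identity
    method.  Put
      H(s,r) = int_B a T(s) T(r),   F(s,r) = int_B q_i(s) T_,i(r).
    H is symmetric, and F = dH/ds by the divergence theorem ([heat_exchange]):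
    the boundary term vanishes because T = 0 on one part of the boundary and
    q.n = 0 on the other.

    Let x and y stand for d/ds and d/dr, and put P(x) = 1 + tau_q x + c x^2 with
    c = tau_q^2 / 2, and Q(y) = 1 + tau_T y.  The constitutive equation turns
    P(x) Q(y) F into - int_B k_ij (Q T_,j)(s) (Q T_,i)(r), which is symmetric in
    s and r as k is.  Hence x P(x) Q(y) - y P(y) Q(x) annihilates H.  This
    antisymmetric polynomial is (x - y) M(x,y) with
      M = 1 + tau_q (x + y) + c (x^2 + x y + y^2) + tau_q tau_T x y
          + c tau_T x y (x + y),
    so M H is constant on the lines s + r = const.  Its value where these lines
    meet the axis s = 0 is zero because of the null initial data, and M H = 0
    ([reduced0]).

    The condition on the delay times leaves two cases.  If tau_q = 0 then M = 1
    and H = 0.  Otherwise tau_T > 0; the principal part c tau_T x y (x + y) of M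
    is strictly hyperbolic for the time s + r, and a Gronwall argument along its
    three families of characteristics gives H = 0 again ([gronwall_two_times]).
    In both cases P(x) Q(y) F = 0 ([flux_power_eq0]).

    On the diagonal s = r this says that int_B k_ij (Q T_,j) (Q T_,i) = 0, and k
    is positive definite: Q T_,i = 0, and P q_i = 0 by the constitutive
    equation.  With null initial values these differential equations in time
    give T_,i = 0 and q = 0.  If a does not vanish, the energy equation is then
    dT/dt = 0, so T = 0; if the first part of the boundary has positive area it
    has a point, where T = 0, and T is constant in space.

    The fields have only the time derivatives named in the equations: q two, T
    and its gradient one.  So H_sss and H_ssrs = (q_tt, T_,it) exist while
    H_ssrr does not, and the differentiation of M H along s + r = const needs
    care in its last term ([is_derive_mixed]). *)

(** * Real functions of one variable *)

Section OneVariable.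
Context {R : realType}.
Implicit Types (f df : R -> R) (x d : R).

(** Derivatives are obtained below as uniform estimates of increments, for which
    this form avoids the division by h. *)
Lemma is_derive1P f x d : is_derive x 1 f d <->
  forall e : R, 0 < e -> exists2 dl : R, 0 < dl &
    forall h, `|h| < dl -> `|f (x + h) - f x - d * h| <= e * `|h|.
Proof.
split=> [[df fd] e e0|H].
- have : h^-1 *: ((f \o shift x) (h *: 1) - f x) @[h --> 0^'] --> d.
    by rewrite -fd; exact: df.
  move=> /cvgrPdist_le /(_ e e0); rewrite near_withinE => -[dl /= dl0 H].
  exists dl => // h hdl; have [->|h0] := eqVneq h 0.
    by rewrite addr0 subrr mulr0 subrr normr0 mulr0.
  have := H h; rewrite /= sub0r normrN => /(_ hdl h0).
  rewrite /= [_ *: 1]mulr1 (addrC h x) [_ *: _]mulrC => E.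
  have -> : f (x + h) - f x - d * h = - ((d - (f (x + h) - f x) / h) * h).
    by field.
  by rewrite normrN normrM ler_wpM2r.
- have H' : h^-1 *: ((f \o shift x) (h *: 1) - f x) @[h --> 0^'] --> d.
    apply/cvgrPdist_le => e e0; have [dl dl0 {}H] := H e e0.
    rewrite near_withinE; exists dl => // h /=; rewrite sub0r normrN => hdl h0.
    rewrite [_ *: 1]mulr1 (addrC h x) [_ *: _]mulrC.
    have h0' : 0 < `|h| by rewrite normr_gt0.
    rewrite -(ler_pM2r h0') -normrM.
    rewrite mulrBl divfK// distrC; exact: H.
  split; last exact/cvg_lim.
  by apply/cvg_ex; exists d.
Qed.

Lemma mvt_ball f df x h :
  (forall y, `|y - x| <= `|h| -> is_derive y 1 f (df y)) ->
  exists2 y, `|y - x| <= `|h| & f (x + h) - f x = df y * h.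
Proof.
move=> H.
have [h0|h0] := leP 0 h; [have le : x <= x + h by rewrite lerDl|
  have le : x + h <= x by rewrite gerDl ltW].
  have [|| y] := @MVT_segment R f df _ _ le.
  - by move=> y; rewrite in_itv/= => /andP[a b]; apply: H; rewrite (ger0_norm h0) ger0_norm; lra.
  - apply: derivable_within_continuous => y; rewrite in_itv/= => /andP[a b].
    by have [] := H y => //; rewrite (ger0_norm h0) ger0_norm; lra.
  rewrite in_itv/= => /andP[a b] E; exists y; first by rewrite (ger0_norm h0) ger0_norm; lra.
  by rewrite E; congr (_ * _); ring.
have [|| y] := @MVT_segment R f df _ _ le.
- move=> y; rewrite in_itv/= => /andP[a b]; apply: H.
  by rewrite (ltr0_norm h0) ler0_norm; lra.
- apply: derivable_within_continuous => y; rewrite in_itv/= => /andP[a b].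
  by have [] := H y => //; rewrite (ltr0_norm h0) ler0_norm; lra.
rewrite in_itv/= => /andP[a b] E; exists y.
  by rewrite (ltr0_norm h0) ler0_norm; lra.
by rewrite -opprB E -mulrN; congr (_ * _); ring.
Qed.

(** K / be * exp (al + be x) is a primitive of the bound.  The factor 1 / be is
    what makes an exponential weight contract in [gronwall_two_times]. *)
Lemma increment_le_expR f df (a b K al be : R) : a <= b -> 0 < be ->
  {within `[a, b], continuous f} ->
  (forall x, a < x < b -> is_derive x 1 f (df x)) ->
  (forall x, a < x < b -> `|df x| <= K * expR (al + be * x)) ->
  0 <= K ->
  `|f b - f a| <= K / be * expR (al + be * b).
Proof.
move=> ab be0 fc fd fb K0.
have := ab; rewrite le_eqVlt => /predU1P[->|{}ab].
  by rewrite subrr normr0 mulr_ge0 ?expR_ge0// divr_ge0// ltW.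
pose E x := K / be * expR (al + be * x).
have Ed x : is_derive x 1 E (K * expR (al + be * x)).
  have e1 : is_derive x 1 (fun x => al + be * x) be.
    have := is_deriveD (is_derive_cst al x (1:R)) (is_deriveZ be (is_derive_id x (1:R))).
    by rewrite add0r [_ *: 1]mulr1.
  have := is_deriveZ (K / be) (is_derive1_comp (is_derive_expR _) e1).
  suff -> : K / be *: (expR (al + be * x) * be) = K * expR (al + be * x) by [].
  have -> (u v : R) : u *: v = u * v by [].
  by field; rewrite gt_eqF.
have Ec : {within `[a, b], continuous E}.
  by apply: derivable_within_continuous => x _; have [] := Ed x.
have Ea : 0 <= E a by rewrite mulr_ge0 ?expR_ge0 ?divr_ge0 ?(ltW be0).
have key (g dg : R -> R) : {within `[a, b], continuous g} ->
  (forall x, a < x < b -> is_derive x 1 g (dg x)) ->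
  (forall x, a < x < b -> `|dg x| <= K * expR (al + be * x)) -> g b - g a <= E b.
  move=> gc gd gb.
  have [|| y] := @MVT R (E - g) (fun x => K * expR (al + be * x) - dg x) _ _ ab.
  - by move=> y; rewrite in_itv/= => yab; have := gd y yab => ?; apply: is_deriveB.
  - by move=> y; apply: continuousB; [exact: Ec|exact: gc].
  rewrite in_itv/= => yab e.
  have {}e : (E b - g b) - (E a - g a) = (K * expR (al + be * y) - dg y) * (b - a) := e.
  have : 0 <= (K * expR (al + be * y) - dg y) * (b - a).
    by rewrite mulr_ge0 ?subr_ge0 ?(ltW ab)// (le_trans (ler_norm _) (gb _ yab)).
  rewrite -{}e; move: Ea; move: (E a) (E b) (g a) (g b) => *; lra.
have [fN|fN] := leP 0 (f b - f a); first by rewrite ger0_norm//; exact: (key f df).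
rewrite ltr0_norm//; have -> : - (f b - f a) = (- f) b - (- f) a by rewrite /= opprB opprK addrC.
apply: (key _ (- df)).
- by move=> y; apply: continuousN; exact: fc.
- by move=> x /fd ?; apply: is_deriveN.
- by move=> x /fb; rewrite normrN.
Qed.
End OneVariable.

(** * Real functions of two variables *)

Section TwoVariables.
Context {R : realType}.
Implicit Types (G : R -> R -> R) (s r : R).

Lemma continuous2P G s r : {for (s, r), continuous (fun z : R * R => G z.1 z.2)} ->
  forall e : R, 0 < e -> exists2 dl : R, 0 < dl &
    forall s' r', `|s' - s| < dl -> `|r' - r| < dl -> `|G s' r' - G s r| <= e.
Proof.
move=> /cvgrPdist_le H e /H [[A B] /= [/nbhs_ballP[d1 /= d10 A1] /nbhs_ballP[d2 /= d20 A2]] AB].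
exists (Num.min d1 d2); first by rewrite lt_min d10.
move=> s' r'; rewrite !lt_min => /andP[s1 s2] /andP[r1 r2].
rewrite distrC; apply: (AB (s', r')); split; [apply: A1|apply: A2].
  by rewrite /ball /= distrC.
by rewrite /ball /= distrC.
Qed.

(** The step (h, e h) is split along the two axes; the mean value theorem on each
    part brings in values of Gs and Gr near the point, where these are
    continuous. *)
Lemma is_derive_along (G Gs Gr : R -> R -> R) (s r e : R) :
  `|e| <= 1 ->
  (\forall z \near (s, r), is_derive (z.1 : R) (1 : R) (G^~ z.2) (Gs z.1 z.2)) ->
  (\forall z \near (s, r), is_derive (z.2 : R) (1 : R) (G z.1) (Gr z.1 z.2)) ->
  {for (s, r), continuous (fun z : R * R => Gs z.1 z.2)} ->
  {for (s, r), continuous (fun z : R * R => Gr z.1 z.2)} ->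
  is_derive (0 : R) 1 (fun h => G (s + h) (r + e * h)) (Gs s r + e * Gr s r).
Proof.
move=> e1 Hs Hr /continuous2P Cs /continuous2P Cr.
have nbh (P : R * R -> Prop) : (\forall z \near (s, r), P z) ->
    exists2 d : R, 0 < d & forall s' r', `|s' - s| < d -> `|r' - r| < d -> P (s', r').
  move=> [[A B] /= [/nbhs_ballP[d1 /= d10 A1] /nbhs_ballP[d2 /= d20 A2]] AB].
  exists (Num.min d1 d2); first by rewrite lt_min d10.
  move=> s' r'; rewrite !lt_min => /andP[s1 s2] /andP[r1 r2].
  by apply: AB; split; [apply: A1|apply: A2]; rewrite /ball /= distrC.
have [d1 d10 {}Hs] := nbh _ Hs; have [d2 d20 {}Hr] := nbh _ Hr.
apply/is_derive1P => ep ep0; have ep2 : 0 < ep / 2 by rewrite divr_gt0.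
have [d3 d30 {}Cs] := Cs _ ep2; have [d4 d40 {}Cr] := Cr _ ep2.
exists (Num.min (Num.min d1 d2) (Num.min d3 d4)); first by rewrite !lt_min d10 d20 d30.
move=> h; rewrite !lt_min => /andP[/andP[h1 h2] /andP[h3 h4]].
have eh : `|e * h| <= `|h| by rewrite normrM ler_piMl.
have rd d : `|h| < d -> `|r + e * h - r| < d.
  by move=> hd; rewrite addrC addKr (le_lt_trans eh).
have [y yh Ey] : exists2 y, `|y - s| <= `|h| &
    G (s + h) (r + e * h) - G s (r + e * h) = Gs y (r + e * h) * h.
  apply: (mvt_ball (f := fun x => G x (r + e * h)) (df := fun x => Gs x (r + e * h))).
  by move=> y yh; apply: (Hs y (r + e * h)); [exact: le_lt_trans yh _|exact: rd].
have [z zh Ez] : exists2 z, `|z - r| <= `|e * h| &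
    G s (r + e * h) - G s r = Gr s z * (e * h).
  apply: (mvt_ball (f := G s) (df := Gr s)) => z zh; apply: (Hr s z).
    by rewrite subrr normr0.
  exact: le_lt_trans zh (le_lt_trans eh _).
rewrite add0r mulr0 !addr0.
have -> : G (s + h) (r + e * h) - G s r - (Gs s r + e * Gr s r) * h =
  (Gs y (r + e * h) - Gs s r) * h + (Gr s z - Gr s r) * (e * h).
  by rewrite mulrBl mulrBl -Ey -Ez; ring.
rewrite (le_trans (ler_normD _ _))// !normrM (splitr ep) mulrDl lerD//.
  by rewrite ler_wpM2r// Cs//; [exact: le_lt_trans h3|exact: rd].
rewrite -normrM ler_pM//; apply: Cr; first by rewrite subrr normr0.
exact: le_lt_trans zh (le_lt_trans eh _).
Qed.

(** Schwarz's theorem in Peano's form: of the two mixed derivatives one is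
    given and continuous, the other comes out of the mean value theorem applied
    twice to the second difference of u. *)
Lemma mixed_derivative (u ux uy uxy : R -> R -> R) (d : R) : 0 < d ->
  (forall x y : R, `|x| < d -> `|y| < d -> is_derive x 1 (u^~ y) (ux x y)) ->
  (forall x y : R, `|x| < d -> `|y| < d -> is_derive y 1 (u x) (uy x y)) ->
  (forall x y : R, `|x| < d -> `|y| < d -> is_derive y 1 (ux x) (uxy x y)) ->
  {for (0, 0), continuous (fun z : R * R => uxy z.1 z.2)} ->
  is_derive (0 : R) 1 (uy^~ 0) (uxy 0 0).
Proof.
move=> d0 Hx Hy Hxy /continuous2P C; apply/is_derive1P => e e0.
have [d1 d10 {}C] := C e e0.
exists (Num.min d d1); first by rewrite lt_min d0.
move=> k; rewrite lt_min add0r => /andP[kd kd1].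
have S l : `|l| < d -> `|l| < d1 ->
    `|u k l - u 0 l - (u k 0 - u 0 0) - k * l * uxy 0 0| <= e * `|k| * `|l|.
  move=> ld ld1.
  have [x xk Ex] : exists2 x, `|x - 0| <= `|k| &
      u (0 + k) l - u (0 + k) 0 - (u 0 l - u 0 0) = (ux x l - ux x 0) * k.
    apply: (mvt_ball (f := fun x => u x l - u x 0) (df := fun x => ux x l - ux x 0)).
    move=> x; rewrite subr0 => xk; have xd := le_lt_trans xk kd.
    have ? := Hx x l xd ld; have ? : is_derive x 1 (u^~ 0) (ux x 0).
      by apply: Hx; rewrite ?normr0.
    exact: is_deriveB.
  rewrite subr0 in xk; have xd := le_lt_trans xk kd.
  have [y yl Ey] : exists2 y, `|y - 0| <= `|l| & ux x (0 + l) - ux x 0 = uxy x y * l.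
    apply: mvt_ball => y; rewrite subr0 => yl; apply: Hxy => //.
    exact: le_lt_trans ld.
  rewrite subr0 in yl; rewrite !add0r in Ex Ey.
  have -> : u k l - u 0 l - (u k 0 - u 0 0) - k * l * uxy 0 0 =
      (uxy x y - uxy 0 0) * (k * l).
    by rewrite mulrBl mulrA (mulrAC _ k l) -Ey -Ex; ring.
  rewrite normrM normrM -!mulrA ler_wpM2r ?mulr_ge0//.
  by apply: C; rewrite subr0; [exact: le_lt_trans kd1|exact: le_lt_trans ld1].
(* as l tends to 0 the second difference of S, divided by l, tends to
   uy k 0 - uy 0 0; l is chosen so that each of the two increments over l is
   within n / 2 of its limit *)
apply/ler_addgt0Pr => n n0.
have n2 : 0 < n / 2 by rewrite divr_gt0.
have H0 : `|0 : R| < d by rewrite normr0.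
have /is_derive1P/(_ _ n2) [a a0 Ha] := Hy k 0 kd H0.
have /is_derive1P/(_ _ n2) [b b0 Hb] := Hy 0 0 H0 H0.
pose l := Num.min (Num.min d d1) (Num.min a b) / 2.
have l0 : 0 < l by rewrite divr_gt0// !lt_min d0 d10 a0.
have lm : l < Num.min (Num.min d d1) (Num.min a b).
  by rewrite ltr_pdivrMr// ltr_pMr ?ltr1n// !lt_min d0 d10 a0.
move: lm; rewrite !lt_min => /andP[/andP[ld ld1] /andP[la lb]].
have nl : `|l| = l by rewrite gtr0_norm.
have := S l; rewrite nl => /(_ ld ld1) Sl.
have := Ha l; rewrite nl add0r => /(_ la) {}Ha.
have := Hb l; rewrite nl add0r => /(_ lb) {}Hb.
rewrite -(ler_pM2r l0) -{1}nl -normrM.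
have -> : (uy k 0 - uy 0 0 - uxy 0 0 * k) * l =
  (u k l - u 0 l - (u k 0 - u 0 0) - k * l * uxy 0 0) +
  ((u 0 l - u 0 0 - uy 0 0 * l) - (u k l - u k 0 - uy k 0 * l)) by ring.
rewrite (le_trans (ler_normD _ _))// mulrDl lerD//.
rewrite (le_trans (ler_normB _ _))// (splitr n) mulrDl lerD//.
Qed.
End TwoVariables.

(** * Functions of two times *)

Section TwoTimes.
Context {R : realType}.
Implicit Types (G H F h : R -> R -> R) (s r : R).

Definition jointly_continuous G := continuous (fun z : R * R => G z.1 z.2).

Definition partial1 G G1 := forall s r, 0 < s -> 0 < r ->
  is_derive s 1 (G^~ r) (G1 s r).

Definition partial2 G G2 := forall s r, 0 < s -> 0 < r ->
  is_derive r 1 (G s) (G2 s r).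

Definition swap G : R -> R -> R := fun s r => G r s.

Lemma jointly_continuous_swap G : jointly_continuous G -> jointly_continuous (swap G).
Proof.
move=> cG [a b]; apply: (@continuous_comp _ _ _ (fun z : R * R => (z.2, z.1))
  (fun z => G z.1 z.2)); last exact: cG.
exact: (@cvg_pair _ _ _ (nbhs (a, b)) (nbhs b) (nbhs a) _ _ _ snd fst
  (@cvg_snd _ _ (nbhs a) (nbhs b) _) (@cvg_fst _ _ (nbhs a) (nbhs b) _)).
Qed.

Lemma partial1_swap G G2 : partial2 G G2 -> partial1 (swap G) (swap G2).
Proof. by move=> d s r s0 r0; apply: d. Qed.

Lemma partial2_swap G G1 : partial1 G G1 -> partial2 (swap G) (swap G1).
Proof. by move=> d s r s0 r0; apply: d. Qed.

Lemma is_derive_shift (f : R -> R) (x b d : R) :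
  is_derive (x + b) 1 f d <-> is_derive x 1 (fun y => f (y + b)) d.
Proof.
rewrite !is_derive1P; split => H e e0; have [dl dl0 {}H] := H e e0; exists dl => // k kdl.
  by rewrite (addrAC x); exact: H.
by have := H k kdl; rewrite (addrAC x).
Qed.

Lemma jointly_continuous_line G (a b u v : R) : jointly_continuous G ->
  continuous (fun x => G (a + u * x) (b + v * x)).
Proof.
move=> cG x.
have lin (a' u' : R) : (fun x => a' + u' * x) @ x --> a' + u' * x.
  by apply: cvgD; [exact: cvg_cst|apply: cvgM; [exact: cvg_cst|exact: cvg_id]].
apply: (@continuous_comp _ _ _ (fun x => (a + u * x, b + v * x))
  (fun z => G z.1 z.2)); last exact: cG.
exact: (cvg_pair (lin a u) (lin b v)).
Qed.

Lemma near_quadrant s r : 0 < s -> 0 < r ->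
  \forall z \near (s, r), 0 < (z.1 : R) /\ 0 < (z.2 : R).
Proof.
move=> s0 r0; exists ([set x | 0 < x], [set x | 0 < x]) => /=.
  by split; apply: lt_nbhsr.
by move=> z [].
Qed.

(** Chain rule on the diagonals (e = 1) and antidiagonals (e = -1). *)
Lemma is_derive_line G G1 G2 s r (e x : R) : `|e| <= 1 ->
  partial1 G G1 -> partial2 G G2 ->
  jointly_continuous G1 -> jointly_continuous G2 ->
  0 < s + x -> 0 < r + e * x ->
  is_derive x 1 (fun x => G (s + x) (r + e * x))
    (G1 (s + x) (r + e * x) + e * G2 (s + x) (r + e * x)).
Proof.
move=> e1 d1 d2 c1 c2 s0 r0; rewrite -[X in is_derive X](add0r x).
rewrite is_derive_shift.
have -> : (fun y => G (s + (y + x)) (r + e * (y + x))) =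
          (fun y => G (s + x + y) (r + e * x + e * y)).
  by apply/funext => y; congr (G _ _); ring.
apply: is_derive_along => //.
- by apply: filterS (near_quadrant s0 r0) => z [z1 z2]; exact: d1.
- by apply: filterS (near_quadrant s0 r0) => z [z1 z2]; exact: d2.
- exact: c1.
- exact: c2.
Qed.

End TwoTimes.

(** * The Lagrange identity *)

Section Lagrange.
Context {R : realType}.
Variables (H F F1 F2 h h1 h2 : R -> R -> R) (tq tT : R).

(** H is the symmetric function, F, F1, F2 are its first three derivatives in s,
    and h, h1, h2 those of F, F1, F2 in r.  The derivative H_ssrr is not among
    them: for int_B a T(s) T(r) it need not exist. *)
Record two_time_family : Prop := TwoTimeFamily {
  ttf_cont : [/\ jointly_continuous H, jointly_continuous F,
    jointly_continuous F1 & jointly_continuous F2];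
  ttf_conth : [/\ jointly_continuous h, jointly_continuous h1 &
    jointly_continuous h2];
  ttf_d1 : [/\ partial1 H F, partial1 F F1, partial1 F1 F2,
    partial1 h h1 & partial1 h1 h2];
  ttf_d2 : [/\ partial2 F h, partial2 F1 h1 & partial2 F2 h2];
  ttf_symH : forall s r, 0 <= s -> 0 <= r -> H s r = H r s;
  ttf_symh : forall s r, 0 <= s -> 0 <= r -> h s r = h r s;
  ttf_init : forall t, 0 <= t -> [/\ H 0 t = 0, F 0 t = 0 & F1 0 t = 0];
  ttf_inith : forall t, 0 <= t -> h 0 t = 0 /\ h1 0 t = 0;
  ttf_axis : forall t, 0 <= t -> [/\ F t 0 = 0, F1 t 0 = 0 & h1 t 0 = 0] }.

Let c : R := 2^-1 * tq ^+ 2.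

(** P(d/ds) Q(d/dr) F, with P(x) = 1 + tq x + c x^2 and Q(y) = 1 + tT y. *)
Definition flux_power s r :=
  (F s r + tq * F1 s r + c * F2 s r) + tT * (h s r + tq * h1 s r + c * h2 s r).

(** M H for the quotient M of x P(x) Q(y) - y P(y) Q(x) by x - y. *)
Definition reduced s r :=
  H s r + tq * (F s r + F r s) + c * (F1 s r + h s r + F1 r s)
  + tq * tT * h s r + c * tT * (h1 s r + h1 r s).

Hypothesis ttf : two_time_family.

Lemma partial2H : partial2 H (swap F).
Proof.
have [Hs _ _ _ _] := ttf_d1 ttf; move=> s r s0 r0.
apply: (@near_eq_is_derive _ _ _ (fun x => H x s)).
- have : \forall x \near r, 0 < x by exact: lt_nbhsr.
  by apply: filterS => x x0; rewrite (ttf_symH ttf) ?(ltW x0) ?(ltW s0).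
- exact: Hs.
Qed.

Lemma partial2h : partial2 h (swap h1).
Proof.
have [_ _ _ hs _] := ttf_d1 ttf; move=> s r s0 r0.
apply: (@near_eq_is_derive _ _ _ (fun x => h x s)).
- have : \forall x \near r, 0 < x by exact: lt_nbhsr.
  by apply: filterS => x x0; rewrite (ttf_symh ttf) ?(ltW x0) ?(ltW s0).
- exact: hs.
Qed.

Lemma partial1Fswap : partial1 (swap F) h.
Proof.
have [Fr _ _] := ttf_d2 ttf; move=> s r s0 r0.
by rewrite (ttf_symh ttf) ?(ltW s0) ?(ltW r0)//; exact: partial1_swap.
Qed.

(** The two terms cannot be differentiated separately: h1 has no derivative in r.
    But their sum is the r-derivative of u = F1 + h, the antidiagonal derivative
    of u is F2 - swap h1, and the latter has the r-derivative h2 - swap h2;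
    [mixed_derivative] exchanges the two operations. *)
Lemma is_derive_mixed s r : 0 < s -> 0 < r ->
  is_derive (0 : R) 1 (fun x => h1 (s + x) (r - x) + h1 (r - x) (s + x))
    (h2 s r - h2 r s).
Proof.
move=> s0 r0.
have [_ _ F1s hs h1s] := ttf_d1 ttf; have [Fr F1r F2r] := ttf_d2 ttf.
have [cH cF cF1 cF2] := ttf_cont ttf; have [ch ch1 ch2] := ttf_conth ttf.
pose d := Num.min s r / 2.
have m0 : 0 < Num.min s r by rewrite lt_min s0.
have d0 : 0 < d by rewrite divr_gt0.
have pos x y : `|x| < d -> `|y| < d -> 0 < s + x /\ 0 < r - x + y.
  rewrite !ltr_norml => /andP[xd1 xd2] /andP[yd1 yd2].
  have : Num.min s r <= s by rewrite ge_min lexx.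
  have : Num.min s r <= r by rewrite ge_min lexx orbT.
  by rewrite /d in xd1 xd2 yd1 yd2 *; split; lra.
pose ux x y := F2 (s + x) (r - x + y) - h1 (r - x + y) (s + x).
pose uy x y := h1 (s + x) (r - x + y) + h1 (r - x + y) (s + x).
pose uxy x y := h2 (s + x) (r - x + y) - h2 (r - x + y) (s + x).
have := @mixed_derivative R (fun x y => F1 (s + x) (r - x + y) + h (s + x) (r - x + y))
  ux uy uxy d d0.
rewrite /uy /uxy /= !addr0 subr0.
have -> : (fun x => h1 (s + x) (r - x + 0) + h1 (r - x + 0) (s + x)) =
          (fun x => h1 (s + x) (r - x) + h1 (r - x) (s + x)).
  by apply/funext => x; rewrite addr0.
apply.
- move=> x y xd yd; have [sx rx] := pos x y xd yd.
  have e1 : `|-1 : R| <= 1 by rewrite normrN normr1.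
  have E (G : R -> R -> R) : (fun x => G (s + x) (r - x + y)) =
      (fun x => G (s + x) (r + y + -1 * x)).
    by apply/funext => z; congr (G _ _); ring.
  have Er : r - x + y = r + y + -1 * x by ring.
  rewrite Er in rx.
  have D1 := is_derive_line e1 F1s F1r cF2 ch1 sx rx.
  have D2 := is_derive_line e1 hs partial2h ch1 (jointly_continuous_swap ch1) sx rx.
  have := is_deriveD D1 D2.
  rewrite (_ : _ + _ + _ = ux x y); last by rewrite /ux /swap Er; ring.
  suff -> : (fun x => F1 (s + x) (r - x + y) + h (s + x) (r - x + y)) =
    ((fun x => F1 (s + x) (r + y + -1 * x)) + (fun x => h (s + x) (r + y + -1 * x))) by [].
  by rewrite -!E.
- move=> x y xd yd; have [sx rx] := pos x y xd yd; rewrite addrC in rx.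
  have E (G : R -> R) : (fun y => G (r - x + y)) = (fun y => G (y + (r - x))).
    by apply/funext => z; rewrite addrC.
  have D1 : is_derive y 1 (fun y => F1 (s + x) (r - x + y)) (h1 (s + x) (r - x + y)).
    by rewrite E (addrC (r - x) y) -is_derive_shift; exact: F1r.
  have D2 : is_derive y 1 (fun y => h (s + x) (r - x + y)) (h1 (r - x + y) (s + x)).
    by rewrite E (addrC (r - x) y) -is_derive_shift; exact: partial2h.
  exact: is_deriveD.
- move=> x y xd yd; have [sx rx] := pos x y xd yd; rewrite addrC in rx.
  have E (G : R -> R) : (fun y => G (r - x + y)) = (fun y => G (y + (r - x))).
    by apply/funext => z; rewrite addrC.
  have D1 : is_derive y 1 (fun y => F2 (s + x) (r - x + y)) (h2 (s + x) (r - x + y)).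
    by rewrite E (addrC (r - x) y) -is_derive_shift; exact: F2r.
  have D2 : is_derive y 1 (fun y => h1 (r - x + y) (s + x)) (h2 (r - x + y) (s + x)).
    rewrite (E (fun z => h1 z (s + x))) (addrC (r - x) y).
    by apply: (proj1 (is_derive_shift (fun z => h1 z (s + x)) _ _ _)); exact: h1s.
  exact: is_deriveB.
- have lin : {for (0, 0), continuous (fun z : R * R => (s + z.1, r - z.1 + z.2))}.
    have c1 : (fun z : R * R => z.1) @ nbhs ((0 : R), (0 : R)) --> (0 : R).
      exact: (@cvg_fst _ _ (nbhs (0:R)) (nbhs (0:R)) _).
    have c2 : (fun z : R * R => z.2) @ nbhs ((0 : R), (0 : R)) --> (0 : R).
      exact: (@cvg_snd _ _ (nbhs (0:R)) (nbhs (0:R)) _).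
    apply: (cvg_pair (G := nbhs (s + 0)) (H := nbhs (r - 0 + 0))).
      by apply: cvgD => //; exact: cvg_cst.
    by apply: cvgD => //; apply: cvgB => //; exact: cvg_cst.
  rewrite /uxy; apply: cvgB.
    apply: (@continuous_comp _ _ _ (fun z : R * R => (s + z.1, r - z.1 + z.2))
      (fun z => h2 z.1 z.2)); [exact: lin|exact: ch2].
  apply: (@continuous_comp _ _ _ (fun z : R * R => (s + z.1, r - z.1 + z.2))
    (fun z => h2 z.2 z.1)); [exact: lin|exact: (jointly_continuous_swap ch2)].
Qed.

Hypothesis power_sym : forall s r, 0 < s -> 0 < r -> flux_power s r = flux_power r s.

(** (x - y) M = x P(x) Q(y) - y P(y) Q(x), so the derivative is the difference of
    the two sides of [power_sym]. *)
Lemma is_derive_reduced s r : 0 < s -> 0 < r ->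
  is_derive (0 : R) 1 (fun x => reduced (s + x) (r - x)) 0.
Proof.
move=> s0 r0.
have [Hs Fs F1s hs h1s] := ttf_d1 ttf; have [Fr F1r F2r] := ttf_d2 ttf.
have [cH cF cF1 cF2] := ttf_cont ttf; have [ch ch1 ch2] := ttf_conth ttf.
have e1 : `|-1 : R| <= 1 by rewrite normrN normr1.
have line G G1 G2 : partial1 G G1 -> partial2 G G2 ->
    jointly_continuous G1 -> jointly_continuous G2 ->
    is_derive (0 : R) 1 (fun x => G (s + x) (r - x)) (G1 s r - G2 s r).
  move=> d1 d2 c1 c2.
  have s0' : 0 < s + 0 by rewrite addr0.
  have r0' : 0 < r + -1 * 0 by rewrite mulr0 addr0.
  have := is_derive_line e1 d1 d2 c1 c2 s0' r0'.
  rewrite mulr0 !addr0 mulN1r.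
  suff -> : (fun x => G (s + x) (r + -1 * x)) = (fun x => G (s + x) (r - x)) by [].
  by apply/funext => x; rewrite mulN1r.
have sw := @jointly_continuous_swap R.
have DH := line _ _ _ Hs partial2H cF (sw _ cF).
have DF := line _ _ _ Fs Fr cF1 ch.
have DF' := line _ _ _ partial1Fswap (partial2_swap Fs) ch (sw _ cF1).
have DF1 := line _ _ _ F1s F1r cF2 ch1.
have DF1' := line _ _ _ (partial1_swap F1r) (partial2_swap F1s) (sw _ ch1) (sw _ cF2).
have Dh := line _ _ _ hs partial2h ch1 (sw _ ch1).
have Dp := is_derive_mixed s0 r0.
have := is_deriveD (is_deriveD (is_deriveD (is_deriveD DH
  (is_deriveZ tq (is_deriveD DF DF')))
  (is_deriveZ c (is_deriveD (is_deriveD DF1 Dh) DF1')))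
  (is_deriveZ (tq * tT) Dh)) (is_deriveZ (c * tT) Dp).
have sc (u v : R) : u *: v = u * v by [].
rewrite !{}sc /swap.
set d := (X in is_derive _ _ _ X).
suff -> : d = 0 by [].
have := power_sym s0 r0; rewrite /flux_power => /eqP; rewrite -subr_eq0 => /eqP <-.
by rewrite /d (ttf_symh ttf (ltW r0) (ltW s0)); ring.
Qed.

Lemma jointly_continuous_reduced : jointly_continuous reduced.
Proof.
have [cH cF cF1 cF2] := ttf_cont ttf; have [ch ch1 ch2] := ttf_conth ttf.
have sw := @jointly_continuous_swap R.
move=> z; rewrite /reduced.
have cM (k : R) (G : R * R -> R) : {for z, continuous G} ->
  {for z, continuous (fun z => k * G z)}.
  by move=> cG; apply: cvgM => //; exact: cvg_cst.
apply: cvgD; last by apply: cM; apply: cvgD; [exact: ch1|exact: sw ch1 z].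
apply: cvgD; last by apply: cM; exact: ch.
apply: cvgD; last first.
  by apply: cM; apply: cvgD; [apply: cvgD; [exact: cF1|exact: ch]|exact: sw cF1 z].
apply: cvgD; first exact: cH.
by apply: cM; apply: cvgD; [exact: cF|exact: sw cF z].
Qed.

(** Every term of [reduced] vanishes on the axis s = 0, which the line
    s + r = const meets. *)
Lemma reduced0 s r : 0 < s -> 0 < r -> reduced s r = 0.
Proof.
move=> s0 r0; pose f x := reduced (0 + 1 * x) (s + r + -1 * x).
have f0 : f 0 = 0.
  rewrite /f !mulr0 !addr0 /reduced; have t0 : 0 <= s + r by rewrite addr_ge0 ?ltW.
  have [-> -> ->] := ttf_init ttf t0; have [-> ->] := ttf_inith ttf t0.
  by have [-> -> ->] := ttf_axis ttf t0; ring.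
have fs : f s = reduced s r.
  by rewrite /f add0r mul1r mulN1r [s + r]addrC addrK.
have [|| x _] := @MVT_segment R f (fun=> 0) 0 s (ltW s0).
- move=> x; rewrite in_itv/= => /andP[x0 xs].
  have rx : 0 < s + r - x by lra.
  have D := is_derive_reduced x0 rx.
  have -> : f = (fun y => (fun z => reduced (x + z) (s + r - x - z)) (y + (- x))).
    by apply/funext => y; rewrite /f; congr (reduced _ _); ring.
  apply: (proj1 (is_derive_shift (fun z => reduced (x + z) (s + r - x - z)) _ _ _)).
  by rewrite subrr.
- by apply: continuous_subspaceT; exact: jointly_continuous_line jointly_continuous_reduced.
by rewrite mul0r f0 subr0 fs.
Qed.
End Lagrange.

(** * Uniqueness for the reduced equation *)

Section Gronwall.
Context {R : realType}.
Variables (H F F1 F2 h h1 h2 : R -> R -> R) (tq tT : R).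
Hypothesis ttf : two_time_family H F F1 F2 h h1 h2.
Hypothesis power_sym : forall s r, 0 < s -> 0 < r ->
  flux_power F F1 F2 h h1 h2 tq tT s r = flux_power F F1 F2 h h1 h2 tq tT r s.
Hypotheses (tq0 : 0 <= tq) (tT0 : 0 <= tT).

Lemma bounded_square (G : R -> R -> R) (A : R) : jointly_continuous G ->
  exists2 M : R, 0 <= M & forall s r, 0 <= s <= A -> 0 <= r <= A -> `|G s r| <= M.
Proof.
move=> cG.
have K : compact (`[0, A] `*` `[0, A] : set (R * R)).
  by apply: compact_setX; exact: segment_compact.
have := continuous_compact (continuous_subspaceT cG) K.
move=> /compact_bounded [M [_ MP]]; exists (`|M| + 1); first by rewrite addr_ge0.
move=> s r sA rA; apply: (MP (`|M| + 1)); first by rewrite (le_lt_trans (ler_norm M))// ltrDl.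
by exists (s, r) => //; split => /=; rewrite in_itv.
Qed.

Lemma geometric_le0 (x K : R) : (forall n : nat, x <= K / 2 ^+ n) -> x <= 0.
Proof.
move=> H'; rewrite leNgt; apply/negP => x0.
have K0 : 0 < K by have := H' 0; rewrite expr0 divr1; exact: lt_le_trans.
have := H' (Num.truncn (K / x)).+1; apply/negP; rewrite -ltNge.
rewrite ltr_pdivrMr ?exprn_gt0// mulrC -ltr_pdivrMr//.
apply: (lt_trans (truncnS_gt _)).
by rewrite -natrX ltr_nat ltn_expl.
Qed.

(** [reduced0] expresses p = h1 + swap h1 by H, F, F1 + h, h and their swaps.
    Now p is the derivative of h along the diagonal and of F1 + h in r, while
    F_r = h and H_s = F: all four are primitives, from an axis where they vanish,
    of combinations of themselves.  Measured with the weight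
    exp (lam (s + r)), lam large, a bound m on the square of side A therefore
    improves to m / 2, and the functions are zero. *)
Lemma gronwall_two_times : 0 < tq -> 0 < tT -> forall s r, 0 <= s -> 0 <= r ->
  h s r = 0 /\ F s r = 0.
Proof.
move=> tqp tTp s0 r0 hs0 hr0.
have [Hs Fs F1s hs h1s] := ttf_d1 ttf; have [Fr F1r F2r] := ttf_d2 ttf.
have [cH cF cF1 cF2] := ttf_cont ttf; have [ch ch1 ch2] := ttf_conth ttf.
pose c : R := 2^-1 * tq ^+ 2.
have c0 : 0 < c by rewrite mulr_gt0 ?exprn_gt0// invr_gt0.
pose A := Num.max s0 r0.
have s0A : 0 <= s0 <= A by rewrite hs0 le_max lexx.
have r0A : 0 <= r0 <= A by rewrite hr0 le_max lexx orbT.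
(* C m bounds p when m bounds the four functions: the coefficients of the
   equation, divided by that of p *)
pose C := (1 + 2 * tq + 3 * c + tq * tT) / (c * tT).
have cT : 0 < c * tT by rewrite mulr_gt0.
have C0 : 0 <= C.
  by rewrite divr_ge0 ?(ltW cT)// !addr_ge0 ?mulr_ge0 ?(ltW c0).
pose lam := 2 * (C + 1).
have lam0 : 0 < lam by rewrite mulr_gt0// ltr_wpDl.
pose E s r := expR (lam * (s + r)).
have E0 s r : 0 <= E s r by exact: expR_ge0.
pose bnd m := forall s r, 0 <= s <= A -> 0 <= r <= A ->
  [/\ `|h s r| <= m * E s r, `|F1 s r + h s r| <= m * E s r,
      `|F s r| <= m * E s r & `|H s r| <= m * E s r].
have half m : 0 <= m -> bnd m -> bnd (m / 2).
  move=> m0 B s r /andP[sp sA] /andP[rp rA].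
  have Esw s' r' : E r' s' = E s' r' by rewrite /E addrC.
  have p_le s' r' : 0 < s' <= A -> 0 < r' <= A ->
      `|h1 s' r' + h1 r' s'| <= C * m * E s' r'.
    move=> /andP[s'0 s'A] /andP[r'0 r'A].
    have [||b1 b2 b3 b4] := B s' r'; rewrite ?(ltW s'0) ?(ltW r'0)//.
    have [||b1' b2' b3' b4'] := B r' s'; rewrite ?(ltW s'0) ?(ltW r'0)//.
    rewrite Esw in b1' b2' b3' b4'.
    have e : c * tT * (h1 s' r' + h1 r' s') =
        - (H s' r' + tq * (F s' r' + F r' s')
        + c * ((F1 s' r' + h s' r') - h s' r' + (F1 r' s' + h r' s'))
        + tq * tT * h s' r').
      have := reduced0 ttf power_sym s'0 r'0; rewrite /reduced -/c => e.
      rewrite -[LHS]addr0 -[X in _ + X](oppr0) -[in X in _ + X]e.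
      by rewrite (ttf_symh ttf (ltW r'0) (ltW s'0)); ring.
    rewrite -(ler_pM2l cT) -{1}(gtr0_norm cT) -normrM e normrN.
    have -> : c * tT * (C * m * E s' r') = m * E s' r' + tq * (m * E s' r' + m * E s' r')
      + c * (m * E s' r' + m * E s' r' + m * E s' r') + tq * tT * (m * E s' r').
      rewrite /C; field; rewrite (gt_eqF c0)// (gt_eqF tTp)//.
    rewrite (le_trans (ler_normD _ _))// lerD//; last first.
      by rewrite normrM (ger0_norm (mulr_ge0 tq0 tT0)) ler_wpM2l// mulr_ge0.
    rewrite (le_trans (ler_normD _ _))// lerD//; last first.
      rewrite normrM (gtr0_norm c0) ler_wpM2l ?(ltW c0)//.
      rewrite (le_trans (ler_normD _ _))// lerD//.
      by rewrite (le_trans (ler_normB _ _))// lerD.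
    rewrite (le_trans (ler_normD _ _))// lerD//.
    rewrite normrM (ger0_norm tq0) ler_wpM2l//.
    by rewrite (le_trans (ler_normD _ _))// lerD.
  have Cm0 : 0 <= C * m by rewrite mulr_ge0.
  have Clam : C * m / lam <= m / 2.
    rewrite ler_pdivrMr// /lam mulrA divfK// mulrC ler_wpM2l//.
    by rewrite lerDl.
  have mlam : m / lam <= m / 2.
    rewrite ler_pdivrMr// /lam mulrA divfK// ler_peMr//.
    by rewrite lerDr.
  split.
  - pose mm := Num.min s r.
    have mms : mm <= s by rewrite ge_min lexx.
    have mmr : mm <= r by rewrite ge_min lexx orbT.
    have mm0 : 0 <= mm by rewrite le_min sp.
    pose f x := h (s - mm + x) (r - mm + 1 * x).
    have fmm : f mm = h s r by rewrite /f mul1r !subrK.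
    have f0 : f 0 = 0.
      rewrite /f mulr0 !addr0 /mm; case: (leP s r) => sr; rewrite subrr.
        have t0 : 0 <= r - s by rewrite subr_ge0.
        by have [->] := ttf_inith ttf t0.
      have t0 : 0 <= s - r by rewrite subr_ge0 ltW.
      by rewrite (ttf_symh ttf t0 (lexx 0)); have [->] := ttf_inith ttf t0.
    have := @increment_le_expR R f (fun x => h1 (s - mm + x) (r - mm + 1 * x)
      + h1 (r - mm + 1 * x) (s - mm + x)) 0 mm (C * m) (lam * (s + r - 2 * mm)) (2 * lam).
    rewrite f0 fmm subr0 => H'.
    apply: (le_trans (H' _ _ _ _ _ _)) => //.
    + by rewrite mulr_gt0.
    + apply: continuous_subspaceT => x.
      have := @jointly_continuous_line _ _ (s - mm) (r - mm) 1 1 ch x.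
      rewrite (_ : (fun x => h (s - mm + 1 * x) (r - mm + 1 * x)) = f)//.
      by apply/funext => y; rewrite /f mul1r.
    + move=> x /andP[x0 xm].
      have e1 : `|1 : R| <= 1 by rewrite normr1.
      have P1 : 0 < s - mm + x by rewrite ltr_wpDl// subr_ge0.
      have P2 : 0 < r - mm + 1 * x by rewrite mul1r ltr_wpDl// subr_ge0.
      have := is_derive_line e1 hs (partial2h ttf) ch1 (jointly_continuous_swap ch1) P1 P2.
      by rewrite [1 * swap _ _ _]mul1r.
    + move=> x /andP[x0 xm]; rewrite (_ : expR _ = E (s - mm + x) (r - mm + 1 * x)).
        by apply: p_le; apply/andP; split; lra.
      by rewrite /E; congr expR; ring.
    + rewrite (_ : expR _ = E s r); last by rewrite /E; congr expR; ring.
      rewrite ler_wpM2r// (le_trans _ Clam)// ler_wpM2l//.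
      have lam2 : lam <= 2 * lam by rewrite ler_peMl ?(ltW lam0)// ler1n.
      by rewrite lef_pV2// posrE// (lt_le_trans lam0).
  - move: sp; rewrite le_eqVlt => /predU1P[s00|sp].
      rewrite -{1 2}s00.
      have [_ _ ->] := ttf_init ttf rp; have [-> _] := ttf_inith ttf rp.
      by rewrite addr0 normr0 mulr_ge0// divr_ge0.
    have f0 : F1 s 0 + h s 0 = 0.
      have [_ -> _] := ttf_axis ttf (ltW sp).
      by rewrite (ttf_symh ttf)// ?(ltW sp)//; have [-> _] := ttf_inith ttf (ltW sp); rewrite addr0.
    have := @increment_le_expR R (fun x => F1 s x + h s x) (fun x => h1 s x + h1 x s) 0 r
      (C * m) (lam * s) lam.
    rewrite f0 subr0 => H'.
    apply: (le_trans (H' _ _ _ _ _ _)) => //.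
    + apply: continuous_subspaceT => x.
      have l G : jointly_continuous G -> {for x, continuous (G s)}.
        move=> cG; have := @jointly_continuous_line _ _ s 0 0 1 cG x.
        rewrite (_ : (fun x => G (s + 0 * x) (0 + 1 * x)) = G s)//.
        by apply/funext => y; rewrite mul0r addr0 add0r mul1r.
      by apply: cvgD; exact: l.
    + move=> x /andP[x0 xr].
      by have := is_deriveD (F1r s x sp x0) (partial2h ttf sp x0).
    + move=> x /andP[x0 xr]; rewrite -mulrDr; apply: p_le; first by rewrite sp.
      by rewrite x0 (le_trans (ltW xr)).
    + by rewrite -mulrDr ler_wpM2r//; exact: E0.
  - move: sp; rewrite le_eqVlt => /predU1P[s00|sp].
      rewrite -{1}s00; have [_ -> _] := ttf_init ttf rp.
      by rewrite normr0 mulr_ge0// divr_ge0.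
    have f0 : F s 0 = 0 by have [] := ttf_axis ttf (ltW sp).
    have := @increment_le_expR R (F s) (h s) 0 r m (lam * s) lam.
    rewrite f0 subr0 => H'.
    apply: (le_trans (H' _ _ _ _ _ _)) => //.
    + apply: continuous_subspaceT => x.
      have := @jointly_continuous_line _ _ s 0 0 1 cF x.
      rewrite (_ : (fun x => F (s + 0 * x) (0 + 1 * x)) = F s)//.
      by apply/funext => y; rewrite mul0r addr0 add0r mul1r.
    + by move=> x /andP[x0 xr]; exact: Fr.
    + move=> x /andP[x0 xr]; rewrite -mulrDr.
      by have [] := B s x; rewrite ?(ltW sp) ?sA ?(ltW x0) ?(le_trans (ltW xr)).
    + by rewrite -mulrDr ler_wpM2r//; exact: E0.
  - move: rp; rewrite le_eqVlt => /predU1P[r00|rp].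
      rewrite -{1}r00 (ttf_symH ttf)//; have [-> _ _] := ttf_init ttf sp.
      by rewrite normr0 mulr_ge0// divr_ge0.
    have f0 : H 0 r = 0 by have [] := ttf_init ttf (ltW rp).
    have := @increment_le_expR R (H^~ r) (F^~ r) 0 s m (lam * r) lam.
    rewrite f0 subr0 => H'.
    apply: (le_trans (H' _ _ _ _ _ _)) => //.
    + apply: continuous_subspaceT => x.
      have := @jointly_continuous_line _ _ 0 r 1 0 cH x.
      rewrite (_ : (fun x => H (0 + 1 * x) (r + 0 * x)) = H^~ r)//.
      by apply/funext => y; rewrite mul0r addr0 add0r mul1r.
    + by move=> x /andP[x0 xr]; exact: Hs.
    + move=> x /andP[x0 xs]; rewrite -mulrDr [r + x]addrC.
      by have [] := B x r; rewrite ?(ltW rp) ?rA ?(ltW x0) ?(le_trans (ltW xs)).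
    + by rewrite -mulrDr [r + s]addrC ler_wpM2r//; exact: E0.
have [M1 M10 B1] := bounded_square A ch.
have [M2 M20 B2] := bounded_square A cF1.
have [M3 M30 B3] := bounded_square A cF.
have [M4 M40 B4] := bounded_square A cH.
pose M := M1 + M2 + M3 + M4.
have M0 : 0 <= M by rewrite !addr_ge0.
have base : bnd M.
  move=> s r sA rA.
  have E1 : 1 <= E s r.
    rewrite /E -[1](@expR0 R) ler_expR mulr_ge0 ?(ltW lam0)// addr_ge0//.
      by case/andP: sA.
    by case/andP: rA.
  have ME : M <= M * E s r by rewrite ler_peMr.
  have := B1 _ _ sA rA; have := B2 _ _ sA rA; have := B3 _ _ sA rA; have := B4 _ _ sA rA.
  have := ler_normD (F1 s r) (h s r); rewrite /M in ME *.
  by split; apply: le_trans ME; lra.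
have all_n n : bnd (M / 2 ^+ n).
  elim: n => [|n IH]; first by rewrite expr0 divr1.
  rewrite exprSr invfM mulrA; apply: half => //.
  by rewrite divr_ge0// exprn_ge0.
have conc (x : R) : (forall n, `|x| <= M / 2 ^+ n * E s0 r0) -> x = 0.
  move=> H'; apply/eqP; rewrite -normr_le0.
  apply: (@geometric_le0 _ (M * E s0 r0)) => n; rewrite mulrAC; exact: H'.
by split; apply: conc => n; have [] := all_n n s0 r0 s0A r0A.
Qed.
End Gronwall.

Section Vanishing.
Context {R : realType}.

Lemma partial1_eq0 (G G1 : R -> R -> R) : partial1 G G1 ->
  (forall s r, 0 < s -> 0 < r -> G s r = 0) ->
  forall s r, 0 < s -> 0 < r -> G1 s r = 0.
Proof.
move=> d G0 s r s0 r0; have [_ <-] := d s r s0 r0.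
rewrite (@near_eq_derive _ _ _ _ (cst 0)) ?derive_cst//.
by near=> x; apply: G0 => //; near: x; exact: lt_nbhsr.
Unshelve. all: by end_near. Qed.

Lemma partial2_eq0 (G G2 : R -> R -> R) : partial2 G G2 ->
  (forall s r, 0 < s -> 0 < r -> G s r = 0) ->
  forall s r, 0 < s -> 0 < r -> G2 s r = 0.
Proof.
move=> d G0 s r s0 r0; apply: (partial1_eq0 (partial1_swap d)) => // s' r' *.
exact: G0.
Qed.

(** When tq = 0 the function [reduced] is H itself. *)
Lemma flux_power_eq0 (H F F1 F2 h h1 h2 : R -> R -> R) (tq tT : R) :
  two_time_family H F F1 F2 h h1 h2 ->
  (forall s r, 0 < s -> 0 < r ->
    flux_power F F1 F2 h h1 h2 tq tT s r = flux_power F F1 F2 h h1 h2 tq tT r s) ->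
  0 <= tq -> 0 <= tT -> tq = 0 \/ 0 < tT ->
  forall s r, 0 < s -> 0 < r -> flux_power F F1 F2 h h1 h2 tq tT s r = 0.
Proof.
move=> ttf sym tq0 tT0 tt.
have [Hs Fs F1s hs h1s] := ttf_d1 ttf; have [Fr _ _] := ttf_d2 ttf.
have [F0 h0] : (forall s r, 0 < s -> 0 < r -> F s r = 0) /\
    (forall s r, 0 < s -> 0 < r -> h s r = 0).
  move: tq0; rewrite le_eqVlt => /predU1P[tq0|tqp].
    have H0 s r : 0 < s -> 0 < r -> H s r = 0.
      by move=> s0 r0; rewrite -(reduced0 ttf sym s0 r0) /reduced -tq0; ring.
    have F0 := partial1_eq0 Hs H0.
    by split=> //; exact: partial2_eq0 Fr F0.
  have {}tT0 : 0 < tT by case: tt => // tq0; rewrite tq0 ltxx in tqp.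
  have G := gronwall_two_times ttf sym (ltW tqp) (ltW tT0) tqp tT0.
  by split=> s r s0 r0; have [] := G s r (ltW s0) (ltW r0).
have F10 := partial1_eq0 Fs F0; have F20 := partial1_eq0 F1s F10.
have h10 := partial1_eq0 hs h0; have h20 := partial1_eq0 h1s h10.
by move=> s r s0 r0; rewrite /flux_power F0// F10// F20// h0// h10// h20//; ring.
Qed.
End Vanishing.

Section ClosedQuadrant.
Context {R : realType}.

Lemma closed_quadrant_eq (G K : R -> R -> R) : jointly_continuous G -> jointly_continuous K ->
  (forall s r, 0 < s -> 0 < r -> G s r = K s r) ->
  forall s r, 0 <= s -> 0 <= r -> G s r = K s r.
Proof.
move=> cG cK GK s r s0 r0; apply/eqP; rewrite -subr_eq0 -normr_le0.
apply/ler_addgt0Pr => e e0; rewrite add0r.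
have e2 : 0 < e / 2 by rewrite divr_gt0.
have [d1 d10 H1] := continuous2P (cG (s, r)) e2.
have [d2 d20 H2] := continuous2P (cK (s, r)) e2.
pose d := Num.min d1 d2 / 2.
have m0 : 0 < Num.min d1 d2 by rewrite lt_min d10.
have d0 : 0 < d by rewrite divr_gt0.
have : d < Num.min d1 d2 by rewrite ltr_pdivrMr// ltr_pMr// ltr1n.
rewrite lt_min => /andP[dd1 dd2].
have near t : `|t + d - t| = d by rewrite addrC addKr gtr0_norm.
have := H1 (s + d) (r + d); rewrite !near => /(_ dd1 dd1) h1.
have := H2 (s + d) (r + d); rewrite !near => /(_ dd2 dd2) h2.
have -> : G s r - K s r = (K (s + d) (r + d) - K s r) - (G (s + d) (r + d) - G s r).
  by rewrite (GK (s + d)) ?ltr_wpDl//; ring.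
by rewrite (le_trans (ler_normB _ _))// (splitr e) lerD.
Qed.
End ClosedQuadrant.

(** * Borel sets and integrability in space *)

Local Notation R3 R :=
  (measurableTypeR R * measurableTypeR R * measurableTypeR R)%type.
Local Notation mu3 R := ((@lebesgue_measure R \x @lebesgue_measure R) \x @lebesgue_measure R)%E.

Section BorelR3.
Context {R : realType}.
Implicit Types (p c : R3 R) (e : R) (O B : set 'rV[R]_3).

Definition cube c e : set (R3 R) :=
  (ball (c.1.1 : R) e `*` ball (c.1.2 : R) e) `*` ball (c.2 : R) e.

Lemma ball_of_R3 c p e : 0 < e -> ball (of_R3 c) e (of_R3 p) <-> cube c e p.
Proof.
move=> e0; split=> [[_ H]|[[H1 H2] H3]].
  have := H 0 (inord 0); have := H 0 (inord 1); have := H 0 (inord 2).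
  by rewrite !mxE !inordK.
split=> // i j; rewrite !mxE.
by case: j => -[|[|[|//]]] ?.
Qed.

Lemma measurable_cube c e : measurable (cube c e).
Proof. by apply: measurableX; [apply: measurableX|]; exact: measurable_realfun.measurable_ball. Qed.

Lemma mu3_cube c e : 0 <= e -> mu3 R (cube c e) = ((2 * e) ^+ 3)%:E.
Proof.
have mb (x : R) : measurable (ball x e : set (measurableTypeR R)).
  exact: measurable_realfun.measurable_ball.
move=> e0; rewrite /cube (product_measure1E _ _ (measurableX (mb _) (mb _)) (mb _)).
rewrite [X in (X * _)%E](product_measure1E _ _ (mb _) (mb _)).
transitivity ((e *+ 2)%:E * (e *+ 2)%:E * (e *+ 2)%:E)%E.
  by congr (_ * _ * _)%E; exact: lebesgue_measure_ball.
by rewrite -!EFinM; congr EFin; ring.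
Qed.

(** The product sigma-algebra is generated by boxes, so O has to be written as a
    countable union of cubes: those with rational centre and size inside O. *)
Lemma measurable_of_R3_open O : open O -> measurable (of_R3 @^-1` O : set (R3 R)).
Proof.
move=> oO.
pose C (q1 q2 q3 q : rat) := cube (ratr q1, ratr q2, ratr q3) (ratr q).
pose D q1 q2 q3 q := if `[< C q1 q2 q3 q `<=` of_R3 @^-1` O >] then C q1 q2 q3 q else set0.
suff -> : of_R3 @^-1` O = \bigcup_q1 \bigcup_q2 \bigcup_q3 \bigcup_q D q1 q2 q3 q.
  do 4 (apply: (@bigcupT_measurable_rat _ (R3 R)) => ?).
  by rewrite /D; case: ifP => _ //; exact: measurable_cube.
rewrite eqEsubset; split=> [p pO|p [q1 _ [q2 _ [q3 _ [q _]]]]]; last first.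
  by rewrite /D; case: asboolP => // S Cp; exact: S.
have /nbhs_ballP[e /= e0 eO] : nbhs (of_R3 p) O by exact: open_nbhs_nbhs.
have e42 : e / 4 < e / 2 by lra.
have [q] := rat_in_itvoo e42; rewrite in_itv/= => /andP[q1 q2].
have q0 : 0 < ratr q :> R by lra.
have near_rat (x : R) : exists a : rat, ball (ratr a : R) (ratr q) x.
  have xq : x - ratr q < x + ratr q by lra.
  have [a] := rat_in_itvoo xq; rewrite in_itv/= => /andP[a1 a2]; exists a.
  by rewrite /ball/= ltr_norml; lra.
have [a1 A1] := near_rat p.1.1; have [a2 A2] := near_rat p.1.2.
have [a3 A3] := near_rat p.2.
exists a1 => //; exists a2 => //; exists a3 => //; exists q => //.
have Cp : C a1 a2 a3 q p by [].
rewrite /D; case: asboolP => // -[]; move=> p' Cp'; apply: eO.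
have /ball_sym b1 := proj2 (ball_of_R3 _ _ q0) Cp.
have b2 := proj2 (ball_of_R3 _ _ q0) Cp'.
apply: le_ball (ball_triangle b1 b2); lra.
Qed.

Lemma within_closure_continuous_in O (f : 'rV[R]_3 -> R) x : open O ->
  {within closure O, continuous f} -> O x -> {for x, continuous f}.
Proof.
move=> oO cf Ox; have := continuous_subspaceW (@subset_closure _ O) cf.
by rewrite continuous_open_subspace// => /(_ x); apply; rewrite inE.
Qed.

Lemma mu3_bounded_finite B : open B -> bounded_set B -> (mu3 R (of_R3 @^-1` B) < +oo)%E.
Proof.
move=> oB [M [_ BM]]; pose m := `|M| + 1.
have m0 : 0 < m by rewrite ltr_wpDl.
apply: (@le_lt_trans _ _ (mu3 R (cube (0, 0, 0) (m + 1)))).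
  apply: le_measure; rewrite ?inE; [exact: measurable_of_R3_open|exact: measurable_cube|].
  move=> p Bp; apply/ball_of_R3; first by rewrite addr_gt0.
  have -> : of_R3 (0, 0, 0) = 0 :> 'rV[R]_3.
    by apply/rowP => i; rewrite !mxE; case: i => -[|[|[|//]]] ?.
  rewrite -ball_normE /= sub0r normrN (@le_lt_trans _ _ m) ?ltrDl//.
  by apply: BM => //; rewrite /m (le_lt_trans (ler_norm M))// ltrDl.
by rewrite mu3_cube ?ltry// addr_ge0 ?(ltW m0).
Qed.

Lemma bounded_closure B : bounded_set B -> bounded_set (closure B).
Proof.
move=> [M [Mr BM]]; exists M; split => // y My x xB.
have cl : closed [set z : 'rV[R]_3 | `|z| <= y].
  apply: (@closed_comp _ _ (fun z : 'rV[R]_3 => `|z|) [set t | t <= y]).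
    by move=> z _; exact: norm_continuous.
  exact: closed_le.
have : closure B `<=` [set z | `|z| <= y].
  rewrite [X in _ `<=` X](proj1 (closure_id _) cl); apply: closure_subset => z Bz; exact: BM.
by apply.
Qed.

Lemma bounded_on_closure B (f : 'rV[R]_3 -> R) : bounded_set B ->
  {within closure B, continuous f} ->
  exists2 M : R, 0 <= M & forall x, closure B x -> `|f x| <= M.
Proof.
move=> bB cf; have K : compact (closure B).
  by apply: bounded_closed_compact; [exact: bounded_closure|exact: closed_closure].
have := continuous_compact cf K => /compact_bounded [M [_ MP]].
exists (`|M| + 1); first by rewrite addr_ge0.
move=> x xB; apply: (MP (`|M| + 1)); first by rewrite (le_lt_trans (ler_norm M))// ltrDl.
by exists x.
Qed.

Lemma integrable_within_closure B (f : 'rV[R]_3 -> R) : open B -> bounded_set B ->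
  {within closure B, continuous f} ->
  (mu3 R).-integrable (of_R3 @^-1` B) (EFin \o (f \o of_R3)).
Proof.
move=> oB bB cf; apply: measurable_bounded_integrable.
- exact: measurable_of_R3_open.
- exact: mu3_bounded_finite.
- move=> mD; apply: (measurability _ (measurable_realfun.RGenOpens.measurableE R)) => //.
  move=> _ [_ [a [b ->] <-]].
  rewrite -[X in measurable X]/(of_R3 @^-1` (B `&` f @^-1` `]a, b[)).
  apply: measurable_of_R3_open; rewrite openE => x [Bx fx].
  apply: filterI; first exact: open_nbhs_nbhs.
  by apply: (within_closure_continuous_in oB cf Bx); apply: open_nbhs_nbhs.
- have [M M0 MP] := bounded_on_closure bB cf.
  exists M; split; first exact: num_real.
  move=> y My p Bp; apply: le_trans (ltW My); apply: MP; exact: subset_closure.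
Qed.
End BorelR3.

(** * The volume integral *)

Section WithinContinuity.
Context {R : realType} {T : topologicalType}.
Implicit Types (A : set T) (f g : T -> R).

Lemma within_continuousD A f g : {within A, continuous f} ->
  {within A, continuous g} -> {within A, continuous (fun x => f x + g x)}.
Proof. by move=> cf cg x; apply: cvgD; [exact: cf|exact: cg]. Qed.

Lemma within_continuousM A f g : {within A, continuous f} ->
  {within A, continuous g} -> {within A, continuous (fun x => f x * g x)}.
Proof. by move=> cf cg x; apply: cvgM; [exact: cf|exact: cg]. Qed.

Lemma within_continuous_cst A (c : R) : {within A, continuous (fun _ : T => c)}.
Proof. by move=> x; exact: cvg_cst. Qed.

Lemma within_continuous_sum A (n : nat) (f : 'I_n -> T -> R) :
  (forall i, {within A, continuous (f i)}) ->
  {within A, continuous (fun x => \sum_(i < n) f i x)}.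
Proof.
elim: n f => [|n IH] f cf.
  rewrite (_ : (fun x => _) = (fun=> 0)); first exact: within_continuous_cst.
  by apply/funext => x; rewrite big_ord0.
rewrite (_ : (fun x => _) = (fun x => \sum_(i < n) f (widen_ord (leqnSn n) i) x + f ord_max x)).
  by apply: within_continuousD => //; apply: IH.
by apply/funext => x; rewrite big_ord_recr.
Qed.
End WithinContinuity.

Section VolumeIntegral.
Context {R : realType} (B : set 'rV[R]_3).
Hypotheses (oB : open B) (bB : bounded_set B).
Implicit Types f g : 'rV[R]_3 -> R.
Local Notation I := (volume_integral B).
Local Notation cont f := {within closure B, continuous f}.

Lemma volume_integral_ext f g : (forall x, B x -> f x = g x) -> I f = I g.
Proof. by move=> fg; apply: eq_Rintegral => p; rewrite inE => Bp; exact: fg. Qed.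

Lemma volume_integralD f g : cont f -> cont g -> I (fun x => f x + g x) = I f + I g.
Proof.
move=> cf cg; apply: RintegralD; first exact: measurable_of_R3_open.
  exact: integrable_within_closure.
exact: integrable_within_closure.
Qed.

Lemma volume_integralZ (c : R) f : cont f -> I (fun x => c * f x) = c * I f.
Proof.
move=> cf; apply: RintegralZl; first exact: measurable_of_R3_open.
exact: integrable_within_closure.
Qed.

Lemma volume_integralB f g : cont f -> cont g -> I (fun x => f x - g x) = I f - I g.
Proof.
move=> cf cg; apply: RintegralB; first exact: measurable_of_R3_open.
  exact: integrable_within_closure.
exact: integrable_within_closure.
Qed.

Lemma volume_integral0 : I (fun=> 0) = 0.
Proof. by rewrite /volume_integral /Rintegral integral0_eq. Qed.

Definition volume : R := fine (mu3 R (of_R3 @^-1` B)).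

Lemma volume_ge0 : 0 <= volume.
Proof. by rewrite /volume fine_ge0// measure_ge0. Qed.

Lemma volume_integral_le f (M : R) : cont f -> (forall x, B x -> `|f x| <= M) ->
  `|I f| <= M * volume.
Proof.
move=> cf fM; have mB := measurable_of_R3_open oB.
have cn : cont (fun x => `|f x|).
  by move=> x; apply: (@cvg_norm _ _ _ _ _ f (f x)); exact: cf.
apply: le_trans (le_normr_Rintegral mB (integrable_within_closure oB bB cf)) _.
rewrite -Rintegral_cst//; apply: le_Rintegral => //.
- exact: (integrable_within_closure oB bB cn).
- exact: (integrable_within_closure oB bB (@within_continuous_cst R _ _ M)).
- by move=> p Bp; exact: fM.
Qed.

(** A positive value at a point would persist on a cube, whose measure is
    positive. *)
Lemma volume_integral_eq0 f : cont f -> (forall x, B x -> 0 <= f x) -> I f = 0 ->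
  forall x, B x -> f x = 0.
Proof.
move=> cf f0 If0 x Bx; apply/eqP; rewrite eq_le f0// andbT leNgt; apply/negP => fx0.
have mB := measurable_of_R3_open oB.
have [e e0 eB] : exists2 e : R, 0 < e & forall y, ball x e y -> B y /\ f x / 2 <= f y.
  have Nf : \forall y \near x, f x / 2 <= f y.
    have fx2 : f x / 2 < f x by rewrite ltr_pdivrMr// ltr_pMr// ltr1n.
    have cfx : f y @[y --> x] --> f x by exact: within_closure_continuous_in oB cf Bx.
    exact: (cvgr_ge _ cfx _ fx2).
  have NB : \forall y \near x, B y by exact: open_nbhs_nbhs.
  have : nbhs x ([set y | B y] `&` [set y | f x / 2 <= f y]) by exact: filterI.
  by move=> /nbhs_ballP[e /= e0 eB]; exists e => // y /eB [].
pose p : R3 R := (x 0 0, x 0 (inord 1), x 0 (inord 2)).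
have px : of_R3 p = x.
  apply/rowP => i; rewrite !mxE.
  by case: i => -[|[|[|//]]] ?; congr (x 0 _); apply/val_inj; rewrite /= ?inordK.
have cubeB : cube p e `<=` of_R3 @^-1` B.
  by move=> y /(proj2 (ball_of_R3 p y e0)); rewrite px => /eB [].
have intf := integrable_within_closure oB bB cf.
have mf := measurable_int _ intf.
have If : (\int[mu3 R]_(y in of_R3 @^-1` B) (f (of_R3 y))%:E = 0)%E.
  by rewrite -(fineK (integrable_fin_num mB intf)); congr EFin.
have mc := measurable_cube p e.
have : ((f x / 2)%:E * mu3 R (cube p e) <= 0)%E.
  rewrite -integral_cst// -If.
  apply: (@le_trans _ _ (\int[mu3 R]_(y in cube p e) (f (of_R3 y))%:E)%E).
    apply: ge0_le_integral => //.
    - by move=> y _; rewrite lee_fin divr_ge0// ltW.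
    - exact: measurable_funS mf.
    - by move=> y /(proj2 (ball_of_R3 p y e0)); rewrite px => /eB []; rewrite lee_fin.
  apply: ge0_subset_integral => //.
  by move=> y By; rewrite lee_fin f0.
rewrite mu3_cube ?(ltW e0)// -EFinM lee_fin leNgt => /negP; apply.
by rewrite mulr_gt0 ?divr_gt0// exprn_gt0// mulr_gt0.
Qed.
End VolumeIntegral.

(** * Pairings of fields at two times *)

Section UniformInSpace.
Context {R : realType} (B : set 'rV[R]_3).
Hypotheses (oB : open B) (bB : bounded_set B).

(** The tube lemma, the closure of B being compact. *)
Lemma uniform_near (Z : topologicalType) (phi : 'rV[R]_3 * Z -> R) (z0 : Z) (e : R) :
  {within closure B `*` setT, continuous phi} -> 0 < e ->
  \forall z \near z0, forall x, closure B x -> `|phi (x, z) - phi (x, z0)| < e.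
Proof.
move=> /subspace_continuousP cphi e0.
have K : compact (closure B).
  by apply: bounded_closed_compact; [exact: bounded_closure|exact: closed_closure].
have H := proj1 (@compact_near_coveringP _ _) K Z (nbhs z0)
  (fun z x => closure B x -> `|phi (x, z) - phi (x, z0)| < e) (nbhs_filter z0).
 apply: filterS (H _) => [z clz x xB|x xB]; first exact: clz.
have e2 : 0 < e / 2 by rewrite divr_gt0.
have /cvgrPdist_lt/(_ _ e2) := cphi (x, z0) (conj xB I).
move=> [[U V] /= [Ux Vz] UV].
exists (U, V) => // -[x' z] /= [Ux' Vz'] x'B.
have := UV (x', z) (conj Ux' Vz') (conj x'B I).
have := UV (x', z0) (conj Ux' (nbhs_singleton Vz)) (conj x'B I).
rewrite /= => h1 h2; rewrite (splitr e).
have -> : phi (x', z) - phi (x', z0) =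
  (phi (x, z0) - phi (x', z0)) - (phi (x, z0) - phi (x', z)) by ring.
by rewrite (le_lt_trans (ler_normB _ _))// ltrD.
Qed.

Lemma within_comp (S T : topologicalType) (A : set S) (A' : set T) (h : S -> T)
    (f : T -> R) : continuous h -> (forall w, A w -> A' (h w)) ->
  {within A', continuous f} -> {within A, continuous (f \o h)}.
Proof.
move=> ch hA /subspace_continuousP cf; apply/subspace_continuousP => w Aw.
apply: cvg_comp (cf _ (hA _ Aw)) => U; rewrite /within /= => HU.
have := ch w _ HU; rewrite /nbhs /=; apply: filterS => y /= Hy Ay.
exact: Hy (hA _ Ay).
Qed.

Lemma within_slice (Z : topologicalType) (phi : 'rV[R]_3 * Z -> R) (z : Z) :
  {within closure B `*` setT, continuous phi} ->
  {within closure B, continuous (fun x => phi (x, z))}.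
Proof.
apply: (@within_comp _ _ _ _ (fun x => (x, z))) => // x.
have c1 : (fun y : 'rV[R]_3 => y) @ nbhs x --> x by exact: cvg_id.
have c2 : (fun _ : 'rV[R]_3 => z) @ nbhs x --> z by exact: cvg_cst.
exact: (cvg_pair c1 c2).
Qed.

Lemma volume_integral_continuous (Z : topologicalType) (phi : 'rV[R]_3 * Z -> R) :
  {within closure B `*` setT, continuous phi} ->
  continuous (fun z => volume_integral B (fun x => phi (x, z))).
Proof.
move=> cphi z0; apply/cvgrPdist_le => e e0.
have V0 : 0 < volume B + 1 by rewrite ltr_wpDl ?volume_ge0.
have eV : 0 < e / (volume B + 1) by rewrite divr_gt0.
apply: filterS (uniform_near z0 cphi eV) => z H.
rewrite distrC -volume_integralB//; [|exact: within_slice..].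
apply: (le_trans (volume_integral_le (M := e / (volume B + 1)) oB bB _ _)).
- apply: within_continuousD; first exact: within_slice.
  by move=> x; apply: cvgN; exact: within_slice.
- by move=> x Bx; apply/ltW/H; exact: subset_closure.
by rewrite mulrAC ler_pdivrMr// ler_wpM2l ?(ltW e0)// lerDl.
Qed.
End UniformInSpace.

Section Pairing.
Context {R : realType} (B : set 'rV[R]_3).
Hypotheses (oB : open B) (bB : bounded_set B).
Implicit Types (f g : 'rV[R]_3 -> R -> R).

Local Notation field f := (continuous_on (closure B) `[0, +oo[ f).

(** Clamping the times at 0 makes pairings continuous on the whole plane, so that
    nothing special happens on the axes.  With n = 1 the pairing is that of two
    scalar fields, with n = 3 that of two vector fields. *)
Definition pairing (n : nat) (f g : 'I_n -> 'rV[R]_3 -> R -> R) (s r : R) : R :=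
  volume_integral B
    (fun x => \sum_(i < n) f i x (Num.max 0 s) * g i x (Num.max 0 r)).

Lemma clamp_continuous : continuous (fun t : R => Num.max 0 t).
Proof.
move=> t; apply: (@continuous_max _ _ (fun=> 0) id); first exact: cvg_cst.
exact: cvg_id.
Qed.

Lemma field_clamp f (Z : topologicalType) (h : Z -> R) : field f -> continuous h ->
  {within closure B `*` setT, continuous (fun w : 'rV[R]_3 * Z => f w.1 (Num.max 0 (h w.2)))}.
Proof.
move=> ff ch; pose k (w : 'rV[R]_3 * Z) := (w.1, Num.max 0 (h w.2)).
apply: (@within_comp _ _ _ _ _ k (fun z => f z.1 z.2)) ff.
  move=> [x z].
  have c1 : (fun w : 'rV[R]_3 * Z => w.1) @ nbhs (x, z) --> x.
    exact: (@cvg_fst _ _ (nbhs x) (nbhs z) _).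
  have c2 : (fun w : 'rV[R]_3 * Z => h w.2) @ nbhs (x, z) --> h z.
    have c0 : (fun w : 'rV[R]_3 * Z => w.2) @ nbhs (x, z) --> z.
      exact: (@cvg_snd _ _ (nbhs x) (nbhs z) _).
    exact: (cvg_comp _ _ c0 (ch z)).
  have c3 : (fun w : 'rV[R]_3 * Z => Num.max 0 (h w.2)) @ nbhs (x, z) --> Num.max 0 (h z).
    exact: (@cvg_comp _ _ _ (fun w : 'rV[R]_3 * Z => h w.2) (fun t : R => Num.max 0 t)
      _ _ _ c2 (clamp_continuous (x := h z))).
  exact: (cvg_pair c1 c3).
by move=> [x z] [xB _]; split => //=; rewrite in_itv/= andbT le_max lexx.
Qed.

Lemma field_at f (t : R) : field f -> 0 <= t -> {within closure B, continuous (f^~ t)}.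
Proof.
have cid : continuous (id : R -> R) by move=> ?; exact: cvg_id.
move=> ff t0; have := within_slice (z := t) (field_clamp ff cid).
by rewrite /= (max_idPr t0).
Qed.

Lemma pairing_continuous n (f g : 'I_n -> 'rV[R]_3 -> R -> R) :
  (forall i, field (f i)) -> (forall i, field (g i)) ->
  jointly_continuous (pairing f g).
Proof.
move=> ff fg; apply: (@volume_integral_continuous _ _ oB bB (R * R)%type
  (fun w => \sum_(i < n) f i w.1 (Num.max 0 w.2.1) * g i w.1 (Num.max 0 w.2.2))).
apply: within_continuous_sum => i; apply: within_continuousM.
  by apply: field_clamp => // -[s r]; exact: (@cvg_fst _ _ (nbhs s) (nbhs r) _).
by apply: field_clamp => // -[s r]; exact: (@cvg_snd _ _ (nbhs s) (nbhs r) _).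
Qed.

Lemma pairingC n (f g : 'I_n -> 'rV[R]_3 -> R -> R) s r :
  pairing f g s r = pairing g f r s.
Proof. by apply: volume_integral_ext => x _; apply: eq_bigr => i _; rewrite mulrC. Qed.

Lemma pairing_integrand n (f g : 'I_n -> 'rV[R]_3 -> R -> R) s r :
  (forall i, field (f i)) -> (forall i, field (g i)) ->
  {within closure B, continuous
    (fun x => \sum_(i < n) f i x (Num.max 0 s) * g i x (Num.max 0 r))}.
Proof.
move=> ff fg; apply: within_continuous_sum => i.
by apply: within_continuousM; apply: field_at => //; rewrite le_max lexx.
Qed.

(** For each x the increment of f is h f'(y) at an intermediate time y, and
    f'(y) is close to f'(s) uniformly in x by [uniform_near]. *)
Lemma pairing_derive1 n (f f' g : 'I_n -> 'rV[R]_3 -> R -> R) (s r : R) :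
  (forall i, field (f i)) -> (forall i, field (f' i)) -> (forall i, field (g i)) ->
  (forall i x (t : R), B x -> 0 < t -> is_derive t 1 (f i x) (f' i x t)) -> 0 < s ->
  is_derive s 1 (fun s => pairing f g s r) (pairing f' g s r).
Proof.
move=> ff ff' fg fd s0; apply/is_derive1P => e e0.
have gM i : {M : R | 0 <= M & forall x, closure B x -> `|g i x (Num.max 0 r)| <= M}.
  apply: cid2; have r0 : 0 <= Num.max 0 r by rewrite le_max lexx.
  exact: bounded_on_closure bB (field_at (fg i) r0).
pose M i := s2val (gM i).
have M0 i : 0 <= M i by rewrite /M; case: (gM i).
have MP i x : closure B x -> `|g i x (Num.max 0 r)| <= M i.
  by rewrite /M; case: (gM i) => ? ? /=; apply.
pose S := \sum_(i < n) M i.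
have S0 : 0 <= S by rewrite sumr_ge0.
have SV : 0 < S * volume B + 1 by rewrite ltr_wpDl ?mulr_ge0 ?volume_ge0.
pose d := e / (S * volume B + 1).
have d0 : 0 < d by rewrite divr_gt0.
have : \forall z \near s, forall i x, closure B x ->
    `|f' i x (Num.max 0 z) - f' i x (Num.max 0 s)| < d.
  have cid : continuous (id : R -> R) by move=> ?; exact: cvg_id.
  have U i := uniform_near bB s (field_clamp (ff' i) cid) d0.
  exact: filter_forall U.
move=> /nbhs_ballP[dl /= dl0 U].
exists (Num.min dl s); first by rewrite lt_min dl0.
move=> h; rewrite lt_min => /andP[hd hs].
have sh : 0 < s + h by move: hs; rewrite ltr_norml => /andP[]; lra.
have inc i x : B x -> `|f i x (s + h) - f i x s - f' i x s * h| <= d * `|h|.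
  move=> Bx; have [y yh ->] : exists2 y, `|y - s| <= `|h| & f i x (s + h) - f i x s = f' i x y * h.
    apply: mvt_ball => y yh; apply: fd => //.
    by have := le_lt_trans yh hs; rewrite ltr_norml => /andP[]; lra.
  have y0 : 0 < y by have := le_lt_trans yh hs; rewrite ltr_norml => /andP[]; lra.
  rewrite -mulrBl normrM ler_wpM2r//.
  have := U y; rewrite /ball/= distrC => /(_ (le_lt_trans yh hd) i x (subset_closure Bx)).
  by rewrite (max_idPr (ltW y0)) (max_idPr (ltW s0)) => /ltW.
have cI (f1 g1 : 'I_n -> 'rV[R]_3 -> R -> R) s1 r1 := @pairing_integrand n f1 g1 s1 r1.
rewrite /pairing [X in _ - X]mulrC -volume_integralZ//; last exact: cI.
have cB (u v : 'rV[R]_3 -> R) : {within closure B, continuous u} ->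
  {within closure B, continuous v} -> {within closure B, continuous (fun x => u x - v x)}.
  by move=> cu cv x; apply: cvgB; [exact: cu|exact: cv].
rewrite -volume_integralB//; [|exact: cI..].
rewrite -volume_integralB//; first last.
- by apply: within_continuousM; [exact: within_continuous_cst|exact: cI].
- by apply: cB; exact: cI.
apply: (le_trans (volume_integral_le (M := S * (d * `|h|)) oB bB _ _)).
- apply: (cB _ _ (cB _ _ (cI _ _ _ _ ff fg) (cI _ _ _ _ ff fg))).
  by apply: within_continuousM; [exact: within_continuous_cst|exact: cI].
- move=> x Bx; rewrite mulr_sumr -!sumrB (le_trans (ler_norm_sum _ _ _))//.
  rewrite /S mulr_suml ler_sum// => i _.
  have -> : f i x (Num.max 0 (s + h)) * g i x (Num.max 0 r) -
      f i x (Num.max 0 s) * g i x (Num.max 0 r) -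
      h * (f' i x (Num.max 0 s) * g i x (Num.max 0 r)) =
      g i x (Num.max 0 r) * (f i x (s + h) - f i x s - f' i x s * h).
    by rewrite (max_idPr (ltW s0)) (max_idPr (ltW sh)); ring.
  rewrite normrM ler_pM//; last exact: inc.
  by apply: MP; exact: subset_closure.
have -> : S * (d * `|h|) * volume B = d * (S * volume B) * `|h| by ring.
rewrite ler_wpM2r// /d mulrAC ler_pdivrMr// ler_wpM2l ?(ltW e0)//.
by rewrite lerDl.
Qed.

Lemma pairing_derive2 n (f g g' : 'I_n -> 'rV[R]_3 -> R -> R) (s r : R) :
  (forall i, field (f i)) -> (forall i, field (g i)) -> (forall i, field (g' i)) ->
  (forall i x (t : R), B x -> 0 < t -> is_derive t 1 (g i x) (g' i x t)) -> 0 < r ->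
  is_derive r 1 (pairing f g s) (pairing f g' s r).
Proof.
move=> ff fg fg' gd r0; rewrite pairingC.
rewrite (_ : pairing f g s = (fun r => pairing g f r s)); last first.
  by apply/funext => r'; rewrite pairingC.
exact: pairing_derive1.
Qed.
End Pairing.

(** * The difference of two solutions *)

Section Difference.
Context {R : realType} (B : set 'rV[R]_3).
Hypothesis oB : open B.
Implicit Types u v w : 'rV[R]_3 -> R -> R.

Definition difference_on u v w := forall x t, B x -> 0 < t -> w x t = u x t - v x t.

Lemma Dt_difference u v w : difference_on u v w -> Dt_exists B u -> Dt_exists B v ->
  Dt_exists B w /\ difference_on (Dt u) (Dt v) (Dt w).
Proof.
move=> E du dv.
have near_eq (x : 'rV[R]_3) (t : R) : B x -> 0 < t -> \forall s \near t, (u x - v x) s = w x s.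
  by move=> Bx t0; near=> s; rewrite E//; near: s; exact: lt_nbhsr.
split=> x t Bx t0.
  apply: near_eq_derivable (near_eq x t Bx t0) _.
  by apply: derivableB; [exact: du|exact: dv].
rewrite /Dt !derive1E -(near_eq_derive _ (near_eq x t Bx t0)) deriveB//.
  exact: du.
exact: dv.
Unshelve. all: by end_near. Qed.

Lemma Dx_difference u v w : difference_on u v w -> Dx_exists B u -> Dx_exists B v ->
  Dx_exists B w /\ forall j, difference_on (Dx j u) (Dx j v) (Dx j w).
Proof.
move=> E du dv.
have near_eq (x : 'rV[R]_3) (t : R) : B x -> 0 < t -> \forall y \near x, (u^~ t - v^~ t) y = w y t.
  move=> Bx t0; have : \forall y \near x, B y by exact: open_nbhs_nbhs.
  by apply: filterS => y By; rewrite E.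
split=> [j x t Bx t0|j x t Bx t0].
  apply: near_eq_derivable (near_eq x t Bx t0) _.
  by apply: derivableB; [exact: du|exact: dv].
rewrite /Dx /dx -(near_eq_derive _ (near_eq x t Bx t0)) deriveB//.
  exact: du.
exact: dv.
Qed.

Lemma continuous_up_to_boundary_difference u v w : difference_on u v w ->
  continuous_up_to_boundary B u -> continuous_up_to_boundary B v ->
  continuous_up_to_boundary B w.
Proof.
move=> E [u' [cu uu']] [v' [cv vv']]; exists (fun x t => u' x t - v' x t); split.
  by move=> z; apply: cvgB; [exact: cu|exact: cv].
by move=> x t Bx t0; rewrite E// uu'// vv'.
Qed.

Definition null_data : data R :=
  Data (fun _ _ => 0) (fun=> 0) (fun=> 0) (fun=> 0) (fun _ _ => 0) (fun _ _ => 0).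

Lemma solution_difference S1 S2 a rho k tau_q tau_T D T1 T2 q1 q2 :
  is_solution B S1 S2 a rho k tau_q tau_T D T1 q1 ->
  is_solution B S1 S2 a rho k tau_q tau_T D T2 q2 ->
  is_solution B S1 S2 a rho k tau_q tau_T null_data
    (fun x t => T1 x t - T2 x t) (fun x t => q1 x t - q2 x t).
Proof.
move=> s1 s2; pose T x t := T1 x t - T2 x t; pose q x t := q1 x t - q2 x t.
have r1 := sol_temp_regular s1; have r2 := sol_temp_regular s2.
have f1 := sol_flux_regular s1; have f2 := sol_flux_regular s2.
have ET : difference_on T1 T2 T by [].
have Eq i : difference_on (flux_comp q1 i) (flux_comp q2 i) (flux_comp q i).
  by move=> x t _ _; rewrite /flux_comp !mxE.
have [dT ETt] := Dt_difference ET (temp_Dt r1) (temp_Dt r2).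
have [xT ETx] := Dx_difference ET (temp_Dx r1) (temp_Dx r2).
have tx j := Dt_difference (ETx j) (temp_DtDx r1 (j := j)) (temp_DtDx r2 (j := j)).
have dq i := Dt_difference (Eq i) (flux_Dt (f1 i)) (flux_Dt (f2 i)).
have xq i := Dx_difference (Eq i) (flux_Dx (f1 i)) (flux_Dx (f2 i)).
have ddq i := Dt_difference (dq i).2 (flux_Dtt (f1 i)) (flux_Dtt (f2 i)).
split.
- split.
  + by move=> z; apply: cvgB; [exact: temp_cont r1 z|exact: temp_cont r2 z].
  + exact: dT.
  + exact: xT.
  + by move=> j; have [] := tx j.
  + by apply: continuous_up_to_boundary_difference ETt _ _; apply: temp_Dt_cont.
  + by move=> j; apply: continuous_up_to_boundary_difference (ETx j) _ _; apply: temp_Dx_cont.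
  + by move=> j; apply: continuous_up_to_boundary_difference (tx j).2 _ _; apply: temp_DtDx_cont.
- move=> i; split.
  + have : continuous_on (closure B) `[0, +oo[
        (fun x t => flux_comp q1 i x t - flux_comp q2 i x t).
      by move=> z; apply: cvgB; [exact: flux_cont (f1 i) z|exact: flux_cont (f2 i) z].
    suff -> : (fun x t => flux_comp q1 i x t - flux_comp q2 i x t) = flux_comp q i by [].
    by apply/funext => x; apply/funext => t; rewrite /flux_comp !mxE.
  + exact: (xq i).1.
  + exact: (dq i).1.
  + exact: (ddq i).1.
  + move=> j; apply: continuous_up_to_boundary_difference ((xq i).2 j) _ _;
      exact: flux_Dx_cont.
  + by apply: continuous_up_to_boundary_difference (dq i).2 _ _; apply: flux_Dt_cont.
  + by apply: continuous_up_to_boundary_difference (ddq i).2 _ _; apply: flux_Dtt_cont.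
- move=> i x t Bx t0; rewrite (Eq i)// (dq i).2// (ddq i).2//.
  under eq_bigr do rewrite ETx// mulrBr.
  under [X in _ = _ - tau_T * X]eq_bigr do rewrite (tx _).2// mulrBr.
  rewrite !sumrB.
  have lin (u1 u2 v1 v2 w1 w2 a1 a2 b1 b2 c : R) :
      u1 + tau_q * v1 + c * w1 = - a1 - tau_T * b1 ->
      u2 + tau_q * v2 + c * w2 = - a2 - tau_T * b2 ->
      u1 - u2 + tau_q * (v1 - v2) + c * (w1 - w2) = - (a1 - a2) - tau_T * (b1 - b2).
    move=> e1 e2; transitivity ((u1 + tau_q * v1 + c * w1) - (u2 + tau_q * v2 + c * w2)).
      by ring.
    by rewrite e1 e2; ring.
  exact: lin (sol_constitutive s1 i Bx t0) (sol_constitutive s2 i Bx t0).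
- move=> x t Bx t0; rewrite ETt// mulrBr -(sol_energy s1 Bx t0) -(sol_energy s2 Bx t0).
  under eq_bigr do rewrite (xq _).2//.
  by rewrite sumrB /=; ring.
- by move=> x xB; rewrite (sol_temp_init s1 xB) (sol_temp_init s2 xB) subrr.
- by move=> x xB; rewrite (sol_flux_init s1 xB) (sol_flux_init s2 xB) subrr.
- move=> x i xB.
  pose g1 h := h^-1 * (flux_comp q1 i x h - flux_comp q1 i x 0).
  pose g2 h := h^-1 * (flux_comp q2 i x h - flux_comp q2 i x 0).
  have E : (fun h => h^-1 * (flux_comp q i x h - flux_comp q i x 0)) = (fun h => g1 h - g2 h).
    by apply/funext => h; rewrite /g1 /g2 /flux_comp !mxE -mulrBr; congr (_ * _); ring.
  have l1 : g1 @ 0^'+ --> flux_rate_init D x 0 i := sol_flux_rate_init s1 (i := i) xB.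
  have l2 : g2 @ 0^'+ --> flux_rate_init D x 0 i := sol_flux_rate_init s2 (i := i) xB.
  have L : (fun h => g1 h - g2 h) @ 0^'+ --> (0 : 'rV[R]_3) 0 i.
    by rewrite mxE -[X in _ --> X](subrr (flux_rate_init D x 0 i)); exact: cvgB l1 l2.
  by rewrite -E in L; exact: L.
- by move=> x t x1 t0; rewrite (sol_temp_boundary s1 x1 t0) (sol_temp_boundary s2 x1 t0) subrr.
- move=> x t x2 t0; rewrite /= -[RHS](subrr (flux_boundary D x t)).
  rewrite -{1}(sol_flux_boundary s1 x2 t0) -(sol_flux_boundary s2 x2 t0) /dot -sumrB.
  by apply: eq_bigr => i _; rewrite !mxE mulrBl.
Qed.
End Difference.

(** * Fields in space and time *)

Section TimeFields.
Context {R : realType} (B : set 'rV[R]_3).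
Hypotheses (oB : open B) (bB : bounded_set B).
Implicit Types (f u v w : 'rV[R]_3 -> R -> R).

Local Notation field f := (continuous_on (closure B) `[0, +oo[ f).

Lemma field_time f x (b : R) : field f -> closure B x -> {within `[0, b], continuous (f x)}.
Proof.
move=> ff xB; apply: (@within_comp _ _ _ _ _ (fun t => (x, t)) (fun z => f z.1 z.2)) ff.
  move=> t; have c1 : (fun _ : R => x) @ nbhs t --> x by exact: cvg_cst.
  have c2 : (fun s : R => s) @ nbhs t --> t by exact: cvg_id.
  exact: (cvg_pair c1 c2).
by move=> t /=; rewrite !in_itv/= => /andP[t0 _]; split; rewrite ?in_itv/= ?t0.
Qed.

Lemma field_near f x (t e : R) : field f -> closure B x -> 0 <= t -> 0 < e ->
  exists2 d : R, 0 < d & forall y s, closure B y -> 0 <= s -> ball x d y ->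
    `|s - t| < d -> `|f y s - f x t| < e.
Proof.
move=> /subspace_continuousP ff xB t0 e0.
have xt : (closure B `*` `[0, +oo[) (x, t) by split => //=; rewrite in_itv/= t0.
have /cvgrPdist_lt/(_ _ e0) := ff _ xt.
move=> [[U V] /= [/nbhs_ballP[d1 /= d10 A1] /nbhs_ballP[d2 /= d20 A2]] UV].
exists (Num.min d1 d2); first by rewrite lt_min d10.
move=> y s yB s0 xy; rewrite lt_min => /andP[_ st]; rewrite distrC.
apply: (UV (y, s)); last by split => //=; rewrite in_itv/= s0.
split; last by apply: A2; rewrite /ball/= distrC.
by apply: A1; apply: le_ball xy; rewrite ge_min lexx.
Qed.

Lemma within_closure_eq0 (f : 'rV[R]_3 -> R) : {within closure B, continuous f} ->
  (forall x, B x -> f x = 0) -> forall x, closure B x -> f x = 0.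
Proof.
move=> /subspace_continuousP cf f0 x xB; apply/eqP; rewrite -normr_le0.
apply/ler_addgt0Pr => e e0; rewrite add0r.
have /cvgrPdist_le/(_ _ e0) := cf x xB.
rewrite /within /= => H; have [y [By Hy]] := xB _ H.
have fxy : `|f x - f y| <= e := Hy (subset_closure By).
by rewrite (f0 y By) subr0 in fxy.
Qed.

Lemma nonincreasing_le0 (E dE : R -> R) :
  (forall b : R, {within `[0, b], continuous E}) ->
  (forall t : R, 0 < t -> is_derive t 1 E (dE t)) ->
  (forall t : R, 0 < t -> dE t <= 0) -> E 0 = 0 -> forall t : R, 0 <= t -> E t <= 0.
Proof.
move=> cE dE' dE0 E0 t; rewrite le_eqVlt => /predU1P[<-|t0]; first by rewrite E0.
have [|| y] := @MVT R E dE 0 t t0 => //.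
  by move=> y; rewrite in_itv/= => /andP[y0 _]; exact: dE'.
rewrite in_itv/= E0 !subr0 => /andP[y0 _] ->.
by rewrite mulr_le0_ge0 ?dE0// ltW.
Qed.

Lemma is_derive_square (u : R -> R) (t d : R) : is_derive t 1 u d ->
  is_derive t 1 (fun s => u s * u s) (2 * (u t * d)).
Proof.
move=> D; have := is_deriveM D D.
have sc (x z : R) : x *: z = x * z by [].
rewrite !{}sc (_ : u t * d + u t * d = 2 * (u t * d)); last by ring.
exact.
Qed.

Lemma square_le0 (x : R) : x * x <= 0 -> x = 0.
Proof. by rewrite -expr2 => h; apply/eqP; rewrite -sqrf_eq0 eq_le h sqr_ge0. Qed.

(** The energy u ^ 2 + c v ^ 2 starts at zero and its rate is - 2 tau v ^ 2. *)
Lemma damped_oscillator_eq0 (u v w : R -> R) (tau c : R) : 0 <= tau -> 0 <= c ->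
  (forall b : R, {within `[0, b], continuous u}) ->
  (forall b : R, {within `[0, b], continuous v}) ->
  (forall t : R, 0 < t -> is_derive t 1 u (v t)) ->
  (forall t : R, 0 < t -> is_derive t 1 v (w t)) ->
  (forall t : R, 0 < t -> u t + tau * v t + c * w t = 0) ->
  u 0 = 0 -> v 0 = 0 -> forall t : R, 0 <= t -> u t = 0.
Proof.
move=> tau0 c0 cu cv du dv ode u0 v0 t t0.
pose E (y : R) : R := u y * u y + c * (v y * v y).
have E_le0 : E t <= 0.
  apply: (@nonincreasing_le0 E (fun y => 2 * (u y * v y) + c * (2 * (v y * w y)))) t0.
  - move=> b; apply: within_continuousD; first exact: within_continuousM.
    apply: within_continuousM; first exact: within_continuous_cst.
    exact: within_continuousM.
  - move=> y y0; have Du := is_derive_square (du y y0).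
    by have := is_deriveD Du (is_deriveZ c (is_derive_square (dv y y0))).
  - move=> y y0; have -> : u y = - (tau * v y + c * w y).
      by have := ode y y0; rewrite -addrA => /eqP; rewrite addr_eq0 => /eqP.
    rewrite (_ : _ + _ = - (2 * tau * (v y * v y))); last by ring.
    by rewrite oppr_le0 -expr2; apply: mulr_ge0; rewrite ?sqr_ge0// mulr_ge0.
  - by rewrite /E u0 v0; ring.
apply: square_le0; apply: le_trans E_le0.
by rewrite lerDl mulr_ge0// -expr2 sqr_ge0.
Qed.

(** The energy u ^ 2 has the rate - 2 tau v ^ 2. *)
Lemma relaxation_eq0 (u v : R -> R) (tau : R) : 0 <= tau ->
  (forall b : R, {within `[0, b], continuous u}) ->
  (forall t : R, 0 < t -> is_derive t 1 u (v t)) ->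
  (forall t : R, 0 < t -> u t + tau * v t = 0) ->
  u 0 = 0 -> forall t : R, 0 <= t -> u t = 0.
Proof.
move=> tau0 cu du ode u0 t t0; apply: square_le0.
apply: (@nonincreasing_le0 (fun y => u y * u y) (fun y => 2 * (u y * v y))) t0.
- by move=> b; exact: within_continuousM.
- by move=> y y0; exact: is_derive_square (du y y0).
- move=> y y0; have -> : u y = - (tau * v y).
    by have := ode y y0 => /eqP; rewrite addr_eq0 => /eqP.
  rewrite (_ : 2 * _ = - (2 * tau * (v y * v y))); last by ring.
  by rewrite oppr_le0 -expr2; apply: mulr_ge0; rewrite ?sqr_ge0// mulr_ge0.
- by rewrite u0 mul0r.
Qed.

Lemma is_derive_direction (f : 'rV[R]_3 -> R) (x v : 'rV[R]_3) (sg : R) :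
  derivable f (x + sg *: v) v ->
  is_derive sg 1 (fun sg => f (x + sg *: v)) ('D_v f (x + sg *: v)).
Proof.
move=> df.
have E : (fun h : R => h^-1 *: (((fun sg => f (x + sg *: v)) \o shift sg) (h *: 1)
      - f (x + sg *: v))) =
    (fun h : R => h^-1 *: ((f \o shift (x + sg *: v)) (h *: v) - f (x + sg *: v))).
  apply/funext => h /=; congr (_ *: (f _ - _)).
  by rewrite [h *: 1]mulr1 scalerDl addrCA.
by split; [rewrite /derivable E; exact: df|rewrite /derive E].
Qed.

Lemma mvt_direction (f g : 'rV[R]_3 -> R) (x v : 'rV[R]_3) (h : R) :
  (forall sg, `|sg| <= `|h| -> derivable f (x + sg *: v) v /\
     'D_v f (x + sg *: v) = g (x + sg *: v)) ->
  exists2 sg, `|sg| <= `|h| & f (x + h *: v) - f x = g (x + sg *: v) * h.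
Proof.
move=> H; have [sg|sg sgh] := @mvt_ball R (fun sg => f (x + sg *: v))
  (fun sg => g (x + sg *: v)) 0 h.
  by rewrite subr0 => /H [d <-]; exact: is_derive_direction.
rewrite add0r scale0r addr0 => E; exists sg => //; by rewrite subr0 in sgh.
Qed.

Lemma ball_basis (x : 'rV[R]_3) (j : 'I_3) (sg e : R) : `|sg| < e ->
  ball x e (x + sg *: Defs.basis j).
Proof.
move=> sge; split; first exact: le_lt_trans sge.
move=> i l; rewrite !mxE /ball/= opprD addNKr normrN normrM.
rewrite (le_lt_trans _ sge)// ler_piMr//.
by case: andP => _; rewrite ?normr1// normr0.
Qed.

(** At time 0 the continuous extension w of a partial derivative of u is not
    itself a derivative.  Over a fixed small step h in space, however, the
    increment of u is h w at an intermediate point, for every t > 0; letting t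
    tend to 0 the increment vanishes while w stays close to w x 0. *)
Lemma gradient_init u w j : field u -> field w ->
  (forall x t, B x -> 0 < t -> derivable (u^~ t) x (Defs.basis j)) ->
  (forall x t, B x -> 0 < t -> Dx j u x t = w x t) ->
  (forall x, B x -> u x 0 = 0) -> forall x, B x -> w x 0 = 0.
Proof.
move=> fu fw du uw u0 x Bx; apply/eqP; rewrite -normr_le0.
apply/ler_addgt0Pr => e e0; rewrite add0r.
have e2 : 0 < e / 2 by rewrite divr_gt0.
have [d1 d10 H1] := field_near fw (subset_closure Bx) (lexx 0) e2.
have /nbhs_ballP[d2 /= d20 H2] : nbhs x B by exact: open_nbhs_nbhs.
pose h := Num.min d1 d2 / 2.
have m0 : 0 < Num.min d1 d2 by rewrite lt_min d10.
have h0 : 0 < h by rewrite divr_gt0.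
have : h < Num.min d1 d2 by rewrite ltr_pdivrMr// ltr_pMr// ltr1n.
rewrite lt_min => /andP[h1 h2].
have nh : `|h| = h by rewrite gtr0_norm.
have Bh sg : `|sg| <= `|h| -> B (x + sg *: Defs.basis j).
  by move=> sgh; apply/H2/ball_basis; rewrite (le_lt_trans sgh)// nh.
have eh : 0 < e / 4 * h by rewrite mulr_gt0// divr_gt0.
have Byh := Bh h (lexx _).
have [d3 d30 H3] := field_near fu (subset_closure Bx) (lexx 0) eh.
have [d4 d40 H4] := field_near fu (subset_closure Byh) (lexx 0) eh.
pose t := Num.min d1 (Num.min d3 d4) / 2.
have mt0 : 0 < Num.min d1 (Num.min d3 d4) by rewrite !lt_min d10 d30.
have t0 : 0 < t by rewrite divr_gt0.
have : t < Num.min d1 (Num.min d3 d4) by rewrite ltr_pdivrMr// ltr_pMr// ltr1n.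
rewrite !lt_min => /and3P[t1 t3 t4].
have nt : `|t - 0| = t by rewrite subr0 gtr0_norm.
have [sg sgh E] : exists2 sg, `|sg| <= `|h| &
    u (x + h *: Defs.basis j) t - u x t = w (x + sg *: Defs.basis j) t * h.
  apply: (@mvt_direction (u^~ t) (w^~ t)) => sg sgh.
  by split; [exact/du/t0/Bh|exact/uw/t0/Bh].
have w1 : `|w (x + sg *: Defs.basis j) t - w x 0| < e / 2.
  apply: H1; rewrite ?nt ?(ltW t0)//; first exact/subset_closure/Bh.
  by apply: ball_basis; rewrite (le_lt_trans sgh)// nh.
have u1 : `|u x t - u x 0| < e / 4 * h.
  by apply: H3; rewrite ?nt ?(ltW t0)//; [exact: subset_closure|exact: ballxx].
have u2 : `|u (x + h *: Defs.basis j) t - u (x + h *: Defs.basis j) 0| < e / 4 * h.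
  by apply: H4; rewrite ?nt ?(ltW t0)//; [exact: subset_closure|exact: ballxx].
rewrite !u0// !subr0 in u1 u2.
have : `|w (x + sg *: Defs.basis j) t| <= e / 2.
  rewrite -(ler_pM2r h0) -{1}nh -normrM -E.
  rewrite (le_trans (ler_normB _ _))//.
  have -> : e / 2 * h = e / 4 * h + e / 4 * h by field.
  by rewrite lerD// ltW.
move=> w2; have -> : w x 0 = w (x + sg *: Defs.basis j) t - (w (x + sg *: Defs.basis j) t - w x 0).
  by rewrite subKr.
by rewrite (le_trans (ler_normB _ _))// (splitr e) lerD// ltW.
Qed.

(** By the mean value theorem the difference quotients of f at 0 are values of f1
    arbitrarily near 0. *)
Lemma rate_init (f f1 : R -> R) : {within `[0, 1], continuous f} ->
  {within `[0, 1], continuous f1} ->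
  (forall t : R, 0 < t -> is_derive t 1 f (f1 t)) ->
  h^-1 * (f h - f 0) @[h --> 0^'+] --> (0 : R) -> f1 0 = 0.
Proof.
move=> cf cf1 df l; apply/eqP; rewrite -normr_le0.
apply/ler_addgt0Pr => e e0; rewrite add0r.
have e2 : 0 < e / 2 by rewrite divr_gt0.
have /cvgrPdist_le/(_ _ e2) [d1 /= d10 H1] := l.
have I0 : `[0, 1]%classic (0 : R) by rewrite /= in_itv/= lexx ler01.
have /subspace_continuousP/(_ 0 I0)/cvgrPdist_le/(_ _ e2) [d2 /= d20 H2] := cf1.
pose h := Num.min 1 (Num.min d1 d2) / 2.
have m0 : 0 < Num.min 1 (Num.min d1 d2) by rewrite !lt_min ltr01 d10.
have h0 : 0 < h by rewrite divr_gt0.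
have : h < Num.min 1 (Num.min d1 d2) by rewrite ltr_pdivrMr// ltr_pMr// ltr1n.
rewrite !lt_min => /and3P[h1 hd1 hd2].
have [|| y] := @MVT R f f1 0 h h0.
- by move=> y; rewrite in_itv/= => /andP[y0 _]; exact: df.
- apply: continuous_subspaceW cf => y /=; rewrite !in_itv/= => /andP[-> yh].
  by rewrite (le_trans yh)// ltW.
rewrite in_itv/= subr0 => /andP[y0 yh] E.
have b0 t d : 0 < t -> t < d -> ball_ Num.norm (0 : R) d t.
  by move=> t0 td; rewrite /= sub0r normrN gtr0_norm.
have a1 : `|0 - h^-1 * (f h - f 0)| <= e / 2 := H1 h (b0 _ _ h0 hd1) h0.
rewrite sub0r normrN E mulrC mulfK ?gt_eqF// in a1.
have yI : y \in `[0, 1] by rewrite in_itv/= (ltW y0) (ltW (lt_trans yh h1)).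
have a2 : `|f1 0 - f1 y| <= e / 2 := H2 y (b0 _ _ y0 (lt_trans yh hd2)) yI.
have -> : f1 0 = (f1 0 - f1 y) + f1 y by rewrite subrK.
by rewrite (le_trans (ler_normD _ _))// (splitr e) lerD.
Qed.

(** f is locally constant, by the mean value theorem along each axis; its level
    sets in B are then both open and closed. *)
Lemma gradient0_constant (f : 'rV[R]_3 -> R) : connected B ->
  (forall i x, B x -> derivable f x (Defs.basis i) /\ dx i f x = 0) ->
  forall x y, B x -> B y -> f x = f y.
Proof.
move=> cB df.
have local x : B x -> exists2 e : R, 0 < e & forall y, ball x e y -> B y /\ f y = f x.
  move=> Bx; have /nbhs_ballP[e /= e0 eB] : nbhs x B by exact: open_nbhs_nbhs.
  exists e => // y xy; split; first exact: eB.
  pose D i := y 0 i - x 0 i.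
  have De i : `|D i| < e by have [_ /(_ 0 i)] := xy; rewrite /ball/= distrC.
  (* a polygon from x = z 0 to y = z 3 with sides parallel to the axes; it stays in
     the ball, which is a cube *)
  pose z (n : nat) : 'rV[R]_3 := \row_i (if (i < n)%N then y 0 i else x 0 i).
  have zB n (j : 'I_3) sg : `|sg| <= `|D j| -> B (z n + (if (j < n)%N then 0 else sg) *: Defs.basis j).
    move=> sgD; apply: eB; split=> // i l; rewrite (ord1 i) !mxE /= /ball/=.
    case: (eqVneq l j) => [->|lj]; rewrite ?mulr0 ?addr0 ?mulr1.
      case: ifP => _; rewrite ?addr0; first by rewrite distrC; exact: De.
      by rewrite opprD addNKr normrN (le_lt_trans sgD).
    by case: ifP => _; [rewrite distrC; exact: De|rewrite subrr normr0].
  have step n : (n < 3)%N -> f (z n.+1) = f (z n).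
    move=> n3; pose j := Ordinal n3.
    have -> : z n.+1 = z n + D j *: Defs.basis j.
      apply/rowP => l; rewrite !mxE /=.
      case: (eqVneq l j) => [->|lj]; rewrite ?mulr1 ?mulr0 ?addr0 /=.
        by rewrite ltnSn ltnn /D addrC subrK.
      by rewrite ltnS leq_eqVlt; move: lj; rewrite -val_eqE /= => /negbTE ->.
    have [sg sgD|sg sgD] := @mvt_direction f (fun=> 0) (z n) (Defs.basis j) (D j).
      by apply: df; have := zB n j sg sgD; rewrite /= ltnn.
    by rewrite mul0r => /eqP; rewrite subr_eq0 => /eqP.
  have <- : z 0%N = x by apply/rowP => i; rewrite mxE.
  have <- : z 3 = y by apply/rowP => i; rewrite mxE ltn_ord.
  by rewrite !step.
move=> x y Bx By.
pose A := [set z | B z /\ f z = f x].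
have AB : A = B.
  apply: cB.
  - by exists x.
  - exists A; last by rewrite eqEsubset; split=> z; [move=> /[dup] -[]|case].
    rewrite openE => z [Bz fz]; have [e e0 H] := local z Bz.
    by apply/nbhs_ballP; exists e => //= v /H [Bv fv]; split; rewrite // fv.
  - exists (~` [set z | B z /\ f z <> f x]).
      apply: open_closedC; rewrite openE => z [Bz fz]; have [e e0 H] := local z Bz.
      by apply/nbhs_ballP; exists e => //= v /H [Bv fv]; split; rewrite // fv.
    rewrite eqEsubset; split=> z [Bz H]; split=> //; first by case.
    by apply: contrapT => fz; apply: H.
by have [_ ->] : A y by rewrite AB.
Qed.

End TimeFields.

(** * Solutions with null data *)

Section NullSolution.
Context {R : realType} (B S1 S2 : set 'rV[R]_3).
Variables (a rho : 'rV[R]_3 -> R) (k : 'rV[R]_3 -> 'M[R]_3) (tq tT : R).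
Variables (T : 'rV[R]_3 -> R -> R) (q : 'rV[R]_3 -> R -> 'rV[R]_3).
Hypotheses (hB : regular_region B) (hS : boundary_decomposition B S1 S2).
Hypotheses (ca : {within closure B, continuous a}).
Hypothesis sol : is_solution B S1 S2 a rho k tq tT (null_data (R := R)) T q.

Local Notation field f := (continuous_on (closure B) `[0, +oo[ f).
Local Notation Q := (flux_comp q).

(** The derivatives in the equations mean nothing on the boundary or at time 0;
    v stands for their continuous extension. *)
Definition extends (u v : 'rV[R]_3 -> R -> R) : Prop :=
  field v /\ forall x t, B x -> 0 < t -> u x t = v x t.

Variables (T' : 'rV[R]_3 -> R -> R) (w w' Q' Q'' : 'I_3 -> 'rV[R]_3 -> R -> R)
  (DQ : 'I_3 -> 'I_3 -> 'rV[R]_3 -> R -> R).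
Hypotheses (eT' : extends (Dt T) T') (ew : forall j, extends (Dx j T) (w j))
  (ew' : forall j, extends (Dt (Dx j T)) (w' j))
  (eQ' : forall i, extends (Dt (Q i)) (Q' i))
  (eQ'' : forall i, extends (Dt (Dt (Q i))) (Q'' i))
  (eDQ : forall i j, extends (Dx j (Q i)) (DQ i j)).

Let oB : open B := region_open hB.
Let bB : bounded_set B := region_bounded hB.
Let regT := sol_temp_regular sol.
Let regQ i := sol_flux_regular sol i.

Let fT : field T := temp_cont regT.
Let fQ i : field (Q i) := flux_cont (regQ i).
Let fT' : field T' := eT'.1.
Let fw j : field (w j) := (ew j).1.
Let fw' j : field (w' j) := (ew' j).1.
Let fQ' i : field (Q' i) := (eQ' i).1.
Let fQ'' i : field (Q'' i) := (eQ'' i).1.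

Lemma is_derive_extension u v v' : Dt_exists B u ->
  (forall x t, B x -> 0 < t -> u x t = v x t) -> extends (Dt u) v' ->
  forall x (t : R), B x -> 0 < t -> is_derive t 1 (v x) (v' x t).
Proof.
move=> du uv [_ duv] x t Bx t0; rewrite -duv//.
have E : \forall s \near t, u x s = v x s.
  by near=> s; apply: uv => //; near: s; exact: lt_nbhsr.
apply: near_eq_is_derive E _; rewrite /Dt derive1E; split=> //; exact: du.
Unshelve. all: by end_near. Qed.

Let dT x (t : R) : B x -> 0 < t -> is_derive t 1 (T x) (T' x t).
Proof. by move: x t; apply: (is_derive_extension (temp_Dt regT) _ eT'). Qed.

Let dw j x (t : R) : B x -> 0 < t -> is_derive t 1 (w j x) (w' j x t).
Proof. by move: x t; apply: (is_derive_extension (temp_DtDx regT (j := j)) (ew j).2 (ew' j)). Qed.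

Let dQ i x (t : R) : B x -> 0 < t -> is_derive t 1 (Q i x) (Q' i x t).
Proof. by move: x t; apply: (is_derive_extension (flux_Dt (regQ i)) _ (eQ' i)). Qed.

Let dQ' i x (t : R) : B x -> 0 < t -> is_derive t 1 (Q' i x) (Q'' i x t).
Proof. by move: x t; apply: (is_derive_extension (flux_Dtt (regQ i)) (eQ' i).2 (eQ'' i)). Qed.

Let T0 x : closure B x -> T x 0 = 0.
Proof. by move=> xB; exact: (sol_temp_init sol xB). Qed.

Let Q0 i x : closure B x -> Q i x 0 = 0.
Proof. by move=> xB; rewrite /flux_comp (sol_flux_init sol xB) mxE. Qed.

Let Q'0 i x : B x -> Q' i x 0 = 0.
Proof.
move=> Bx; have xB := subset_closure Bx.
apply: (@rate_init R (Q i x)).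
- exact: field_time.
- exact: field_time.
- by move=> t t0; exact: dQ.
- by have := sol_flux_rate_init sol (i := i) xB; rewrite mxE.
Qed.

Let w0 j x : B x -> w j x 0 = 0.
Proof.
apply: (gradient_init oB fT (@fw j) (j := j)).
- by move=> y t By t0; exact: (temp_Dx regT).
- exact: (ew j).2.
- by move=> y By; apply: T0; exact: subset_closure.
Qed.

Let energy x t : B x -> 0 < t -> \sum_(i < 3) Dx i (Q i) x t = - (a x * T' x t).
Proof.
move=> Bx t0; rewrite -(eT'.2 x t Bx t0) -(sol_energy sol Bx t0).
by rewrite mulr0 addr0 opprK.
Qed.

Let aT x t := a x * T x t.
Let aT' x t := a x * T' x t.

Lemma field_mul (g : 'rV[R]_3 -> R) f : {within closure B, continuous g} -> field f ->
  field (fun x t => g x * f x t).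
Proof.
move=> cg cf; apply: within_continuousM => //.
apply: (@within_comp _ _ _ _ _ fst g) cg; last by move=> z [].
by move=> [x t]; exact: (@cvg_fst _ _ (nbhs x) (nbhs t) _).
Qed.

Let faT : field aT. Proof. exact: field_mul. Qed.
Let faT' : field aT'. Proof. exact: field_mul. Qed.

Let sc (f : 'rV[R]_3 -> R -> R) := fun _ : 'I_1 => f.

(** Divergence theorem for T(r) q(s): the flux through the boundary vanishes,
    since T vanishes on the closure of S1 and the normal component of q on S2. *)
Lemma heat_exchange s r : 0 < s -> 0 < r ->
  pairing B Q w s r = pairing B (sc aT') (sc T) s r.
Proof.
move=> s0 r0; have [sigma [_ divB]] := region_divergence hB.
pose F x : 'rV[R]_3 := T x r *: q x s.
have EF i : (fun x => F x 0 i) = (fun x => T x r * Q i x s).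
  by apply/funext => x; rewrite !mxE.
have dF i j x : B x -> derivable (fun x => T x r * Q i x s) x (Defs.basis j) /\
    dx j (fun x => T x r * Q i x s) x = T x r * DQ i j x s + Q i x s * w j x r.
  move=> Bx; have d1 : derivable (T^~ r) x (Defs.basis j) by exact: (temp_Dx regT).
  have d2 : derivable ((Q i)^~ s) x (Defs.basis j) by exact: (flux_Dx (regQ i)).
  split; first exact: derivableM.
  rewrite -(ew j).2// -(eDQ i j).2//; exact: deriveM d1 d2.
have CF i : C1_closure B (fun x => F x 0 i).
  rewrite EF; split.
    by apply: within_continuousM; apply: field_at => //; exact: ltW.
  move=> j; split; first by move=> x /(dF i j) [].
  exists (fun x => T x r * DQ i j x s + Q i x s * w j x r).
  split; last by move=> x /(dF i j) [].
  by apply: within_continuousD; apply: within_continuousM; apply: field_at;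
    rewrite ?ltW//; case: (eDQ i j).
have bd : Rintegral sigma (of_R3 @^-1` normal_part B)
    ((fun x => dot (F x) (outward_normal B x)) \o of_R3) = 0.
  rewrite /Rintegral integral0_eq// => p np /=; congr EFin.
  have dF0 : dot (F (of_R3 p)) (outward_normal B (of_R3 p)) =
      T (of_R3 p) r * dot (q (of_R3 p) s) (outward_normal B (of_R3 p)).
    by rewrite /dot mulr_sumr; apply: eq_bigr => i _; rewrite mxE mulrA.
  rewrite dF0; have := decomp_cover hS => cov.
  have : (closure S1 `|` S2) (of_R3 p) by rewrite cov; case: np.
  case=> [x1|x2]; first by rewrite (sol_temp_boundary sol x1 (ltW r0)) mul0r.
  by rewrite (sol_flux_boundary sol (conj x2 np) (ltW s0)) mulr0.
have := divB F CF; rewrite {}bd.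
rewrite (@volume_integral_ext _ B _ (fun x =>
  (\sum_(i < 3) Q i x (Num.max 0 s) * w i x (Num.max 0 r)) -
  (\sum_(i < 1) sc aT' i x (Num.max 0 s) * sc T i x (Num.max 0 r)))); last first.
  move=> x Bx; rewrite /divergence.
  under eq_bigr => i _.
    rewrite EF (dF i i x Bx).2 -(eDQ i i).2//.
    over.
  rewrite big_split /= -mulr_sumr energy// big_ord1 /sc /aT' (max_idPr (ltW s0)) (max_idPr (ltW r0)).
  by rewrite mulrN addrC [X in _ - X]mulrC.
rewrite volume_integralB//; [|exact: pairing_integrand..].
by move=> /eqP; rewrite subr_eq0 => /eqP.
Qed.

Let H := pairing B (sc aT) (sc T).
Let F := pairing B Q w.
Let F1 := pairing B Q' w.
Let F2 := pairing B Q'' w.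
Let h := pairing B Q w'.
Let h1 := pairing B Q' w'.
Let h2 := pairing B Q'' w'.

(** The r-derivative of [heat_exchange]; its right side shows that h is symmetric. *)
Let mixed_heat_exchange s r : 0 < s -> 0 < r -> h s r = pairing B (sc aT') (sc T') s r.
Proof.
move=> s0 r0.
have D1 : is_derive r 1 (F s) (h s r) by apply: pairing_derive2.
have D2 : is_derive r 1 (pairing B (sc aT') (sc T) s) (pairing B (sc aT') (sc T') s r).
  by apply: pairing_derive2 => // _; exact: dT.
have D3 : is_derive r 1 (F s) (pairing B (sc aT') (sc T') s r).
  apply: near_eq_is_derive D2; near=> x; rewrite -heat_exchange//.
  by near: x; exact: lt_nbhsr.
by have [_ <-] := D1; have [_ <-] := D3.
Unshelve. all: by end_near. Qed.

Let mixed_symmetric s r : 0 <= s -> 0 <= r -> h s r = h r s.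
Proof.
have ch : jointly_continuous h by exact: pairing_continuous.
apply: (closed_quadrant_eq ch (jointly_continuous_swap ch)) => {}s {}r s0 r0.
rewrite /swap mixed_heat_exchange// mixed_heat_exchange// pairingC; apply: volume_integral_ext => x _.
by rewrite !big_ord1 /sc /aT'; ring.
Qed.

Let pairing_init (f g : 'I_3 -> 'rV[R]_3 -> R -> R) t :
  (forall i x, B x -> f i x 0 = 0) -> pairing B f g 0 t = 0.
Proof.
move=> f0; rewrite -[RHS](volume_integral0 B); apply: volume_integral_ext => x Bx.
by rewrite big1// => i _; rewrite maxxx f0// mul0r.
Qed.

Let axis_derive (f f' g : 'I_3 -> 'rV[R]_3 -> R -> R) :
  (forall i, field (f i)) -> (forall i, field (f' i)) -> (forall i, field (g i)) ->
  (forall i x (t : R), B x -> 0 < t -> is_derive t 1 (f i x) (f' i x t)) ->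
  (forall t, 0 <= t -> pairing B f g t 0 = 0) ->
  forall t, 0 < t -> pairing B f' g t 0 = 0.
Proof.
move=> ff ff' fg df z t t0.
have [_ <-] := pairing_derive1 oB bB 0 ff ff' fg df t0.
rewrite (@near_eq_derive _ _ _ _ (cst 0)) ?derive_cst//.
by near=> x; apply: z; apply: ltW; near: x; exact: lt_nbhsr.
Unshelve. all: by end_near. Qed.

Lemma null_two_time_family : two_time_family H F F1 F2 h h1 h2.
Proof.
have Q0B i x : B x -> Q i x 0 = 0 by move=> /subset_closure /Q0.
have F_axis t : F t 0 = 0 by rewrite /F pairingC; exact: pairing_init.
have F1_axis t : F1 t 0 = 0 by rewrite /F1 pairingC; exact: pairing_init.
have h_axis t : 0 <= t -> h t 0 = 0 by move=> t0; rewrite mixed_symmetric//; exact: pairing_init.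
have h1_axis t : 0 <= t -> h1 t 0 = 0.
  rewrite le_eqVlt => /predU1P[<-|t0]; first exact: pairing_init.
  exact: axis_derive h_axis t t0.
split.
- by split; exact: pairing_continuous.
- by split; exact: pairing_continuous.
- split; move=> s r s0 r0; try exact: pairing_derive1.
  rewrite -[F s r]/(pairing B Q w s r) heat_exchange//; apply: pairing_derive1 => // i x t Bx t0.
  exact: is_deriveZ (dT Bx t0).
- by split; move=> s r s0 r0; exact: pairing_derive2.
- move=> s r _ _; rewrite /H pairingC; apply: volume_integral_ext => x _.
  by rewrite !big_ord1 /sc /aT; ring.
- exact: mixed_symmetric.
- move=> t t0; split; [|exact: pairing_init..].
  rewrite -[RHS](volume_integral0 B); apply: volume_integral_ext => x Bx.
  by rewrite big_ord1 /sc /aT maxxx T0 ?mulr0 ?mul0r//; exact: subset_closure.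
- by move=> t t0; split; exact: pairing_init.
- by move=> t t0; rewrite h1_axis.
Qed.

Hypotheses (tq0 : 0 <= tq) (tT0 : 0 <= tT) (tqT : tq = 0 \/ 0 < tT).
Hypothesis ksym : forall x, closure B x -> (k x)^T = k x.
Hypothesis kpos : forall x, closure B x -> exists2 m : R, 0 < m &
  forall v : 'rV[R]_3, m * dot v v <= quadratic_form (k x) v.

Let c : R := 2^-1 * tq ^+ 2.
Let P i x t := Q i x t + tq * Q' i x t + c * Q'' i x t.
Let V j x t := w j x t + tT * w' j x t.

Lemma pairingDl n (f f' g : 'I_n -> 'rV[R]_3 -> R -> R) (al s r : R) :
  (forall i, field (f i)) -> (forall i, field (f' i)) -> (forall i, field (g i)) ->
  pairing B (fun i x t => f i x t + al * f' i x t) g s r =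
  pairing B f g s r + al * pairing B f' g s r.
Proof.
move=> ff ff' fg; rewrite /pairing -volume_integralZ//; last exact: pairing_integrand.
rewrite -volume_integralD//; last first.
- by apply: within_continuousM; [exact: within_continuous_cst|exact: pairing_integrand].
- exact: pairing_integrand.
apply: volume_integral_ext => x _; rewrite mulr_sumr -big_split /=.
by apply: eq_bigr => i _; ring.
Qed.

Lemma field_lin f f' (al : R) : field f -> field f' ->
  field (fun x t => f x t + al * f' x t).
Proof.
move=> ff ff'; apply: within_continuousD => //.
by apply: within_continuousM => //; exact: within_continuous_cst.
Qed.

Let fP i : field (P i).
Proof. by apply: field_lin => //; exact: field_lin. Qed.

Let fV j : field (V j).
Proof. exact: field_lin. Qed.

Let constitutive i x t : B x -> 0 < t -> P i x t = - \sum_(j < 3) k x i j * V j x t.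
Proof.
move=> Bx t0; rewrite /P -(eQ' i).2// -(eQ'' i).2// (sol_constitutive sol i Bx t0).
rewrite mulr_sumr -sumrN -sumrB -sumrN; apply: eq_bigr => j _.
by rewrite /V -(ew j).2// -(ew' j).2//; ring.
Qed.

Lemma flux_power_pairing s r : flux_power F F1 F2 h h1 h2 tq tT s r = pairing B P V s r.
Proof.
have expand (g : 'I_3 -> 'rV[R]_3 -> R -> R) : (forall i, field (g i)) ->
    pairing B P g s r =
    pairing B Q g s r + tq * pairing B Q' g s r + c * pairing B Q'' g s r.
  move=> fg; rewrite pairingDl//; last by move=> i; exact: field_lin.
  by rewrite pairingDl.
by rewrite pairingC pairingDl// pairingC [X in _ + _ * X]pairingC !expand.
Qed.

Lemma flux_power_sym s r : 0 < s -> 0 < r ->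
  flux_power F F1 F2 h h1 h2 tq tT s r = flux_power F F1 F2 h h1 h2 tq tT r s.
Proof.
move=> s0 r0; rewrite !flux_power_pairing; apply: volume_integral_ext => x Bx.
rewrite (max_idPr (ltW s0)) (max_idPr (ltW r0)).
under eq_bigr do rewrite constitutive// mulNr mulr_suml.
under [RHS]eq_bigr do rewrite constitutive// mulNr mulr_suml.
rewrite !sumrN exchange_big /=; congr (- _).
apply: eq_bigr => i _; apply: eq_bigr => j _.
have -> : k x j i = k x i j by rewrite -[in RHS](ksym (subset_closure Bx)) mxE.
by ring.
Qed.

(** [flux_power_eq0] at s = r: the integral over B of the quadratic form of k at
    the vector V is zero. *)
Lemma conductive_gradient_eq0 j x t : B x -> 0 < t -> V j x t = 0.
Proof.
move=> Bx t0; have := flux_power_eq0 null_two_time_family flux_power_sym tq0 tT0 tqT t0 t0.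
rewrite flux_power_pairing => P0.
pose f y := - 1 * \sum_(i < 3) P i y (Num.max 0 t) * V i y (Num.max 0 t).
pose v y : 'rV[R]_3 := \row_i V i y t.
have fq y : B y -> f y = quadratic_form (k y) (v y).
  move=> By; rewrite /f mulN1r (max_idPr (ltW t0)) -sumrN; apply: eq_bigr => i _.
  rewrite constitutive// mulNr opprK mulr_suml; apply: eq_bigr => l _.
  by rewrite !mxE; ring.
have dot0 u : 0 <= dot u u :> R by apply: sumr_ge0 => i _; rewrite -expr2 sqr_ge0.
have cf : {within closure B, continuous f}.
  by apply: within_continuousM; [exact: within_continuous_cst|exact: pairing_integrand].
have f0 y : B y -> 0 <= f y.
  move=> By; rewrite fq//; have [m m0 mP] := kpos (subset_closure By).
  by apply: le_trans (mP _); rewrite mulr_ge0// ltW.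
have If : volume_integral B f = 0.
  by rewrite volume_integralZ//; [rewrite -/(pairing B P V t t) P0 mulr0|exact: pairing_integrand].
have := volume_integral_eq0 oB bB cf f0 If Bx; rewrite fq// => q0.
have [m m0 mP] := kpos (subset_closure Bx).
have : dot (v x) (v x) <= 0.
  by rewrite -(ler_pM2l m0) mulr0 -q0.
rewrite /dot => vv0.
have v2 (i : 'I_3) : true -> 0 <= v x 0 i * v x 0 i by rewrite -expr2 sqr_ge0.
have vv : \sum_(i < 3) v x 0 i * v x 0 i = 0 by apply/eqP; rewrite eq_le vv0 dot0.
have := psumr_eq0P v2 vv (i := j) isT.
by move=> /eqP; rewrite mulf_eq0 orbb mxE => /eqP.
Qed.

Lemma null_flux x t : closure B x -> 0 <= t -> q x t = 0.
Proof.
have inB i y s : B y -> 0 <= s -> Q i y s = 0.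
  move=> By; have yB := subset_closure By; move: s.
  apply: (@damped_oscillator_eq0 R (Q i y) (Q' i y) (Q'' i y) tq c).
  - exact: tq0.
  - by rewrite mulr_ge0// sqr_ge0.
  - by move=> b; exact: field_time.
  - by move=> b; exact: field_time.
  - by move=> s s0; exact: dQ.
  - by move=> s s0; exact: dQ'.
  - move=> s s0; have := constitutive i By s0; rewrite /P => ->.
    by rewrite big1 ?oppr0// => j _; rewrite conductive_gradient_eq0// mulr0.
  - exact: Q0.
  - exact: Q'0.
move=> xB t0; apply/rowP => i; rewrite [RHS]mxE.
apply: (@within_closure_eq0 R B (fun y => Q i y t)) xB; first exact: field_at.
by move=> y By; exact: inB.
Qed.

Lemma null_gradient j x t : B x -> 0 <= t -> w j x t = 0.
Proof.
move=> Bx; have xB := subset_closure Bx; move: t.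
apply: (@relaxation_eq0 R (w j x) (w' j x) tT tT0).
- by move=> b; exact: field_time.
- by move=> s s0; exact: dw.
- by move=> s s0; exact: conductive_gradient_eq0.
- exact: w0.
Qed.

Lemma null_temperature_capacity : (forall x, closure B x -> a x <> 0) ->
  forall x t, closure B x -> 0 <= t -> T x t = 0.
Proof.
move=> a0.
have T'0 x t : B x -> 0 < t -> T' x t = 0.
  move=> Bx t0; have := energy Bx t0; rewrite big1.
    move=> /esym/eqP; rewrite oppr_eq0 mulf_eq0 => /orP[/eqP|/eqP//].
    by move=> /a0 []; exact: subset_closure.
  move=> i _; rewrite /Dx /dx (@near_eq_derive _ _ _ _ (cst 0)) ?derive_cst//.
  have : \forall y \near x, B y by exact: open_nbhs_nbhs.
  by apply: filterS => y By; rewrite /flux_comp null_flux ?mxE ?ltW//; exact: subset_closure.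
move=> x t xB t0; apply: (@within_closure_eq0 R B (T^~ t)) xB; first exact: field_at.
move=> y By; have yB := subset_closure By.
move: t0; rewrite le_eqVlt => /predU1P[<-|t0]; first exact: T0.
have [|| s] := @MVT R (T y) (T' y) 0 t t0.
- by move=> s; rewrite in_itv/= => /andP[s0 _]; exact: dT.
- exact: field_time.
by rewrite in_itv/= => /andP[s0 _]; rewrite T'0// mul0r T0// subr0.
Qed.

(** A point of S1 lies in the closure of B, where T is constant in space. *)
Lemma null_temperature_boundary : S1 !=set0 ->
  forall x t, closure B x -> 0 <= t -> T x t = 0.
Proof.
move=> [z Sz] x t xB t0; have zS := subset_closure Sz.
have zB : closure B z by have [] := decomp_sub1 hS Sz.
have grad i y : B y -> derivable (T^~ t) y (Defs.basis i) /\ dx i (T^~ t) y = 0.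
  move: t0; rewrite le_eqVlt => /predU1P[<-|{}t0] By; last first.
    split; first exact: (temp_Dx regT).
    by rewrite -/(Dx i T y t) (ew i).2// null_gradient// ltW.
  have E : \forall v \near y, cst 0 v = T v 0.
    have : \forall v \near y, B v by exact: open_nbhs_nbhs.
    by apply: filterS => v /subset_closure /T0.
  split; first by apply: near_eq_derivable E _; exact: derivable_cst.
  by rewrite /dx -(near_eq_derive _ E) derive_cst.
have [y0 By0] := region_nonempty hB.
have Tc y : B y -> T y t - T y0 t = 0.
  by move=> By; rewrite (gradient0_constant oB (region_connected hB) grad By By0) subrr.
have cD : {within closure B, continuous (fun y => T y t - T y0 t)}.
  by apply: within_continuousD; [exact: field_at|exact: within_continuous_cst].
have Tcl y : closure B y -> T y t = T y0 t.
  by move=> yB; apply/eqP; rewrite -subr_eq0; apply/eqP; exact: (within_closure_eq0 cD Tc yB).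
by rewrite Tcl// -(Tcl z)// (sol_temp_boundary sol zS t0).
Qed.
End NullSolution.

(** * Uniqueness *)

Section UniquenessProof.
Context {R : realType}.

Lemma area_set0 : area (set0 : set 'rV[R]_3) = 0%E.
Proof.
have H0 (delta : R) : 0 < delta -> hausdorff2_delta delta (set0 : set 'rV[R]_3) = 0%E.
  move=> d0; apply/eqP; rewrite eq_le; apply/andP; split.
    apply: ereal_inf_lbound; exists (fun=> set0), (fun=> 0); split => //.
    - by move=> n; rewrite lexx ltW.
    - rewrite (@eq_eseriesr _ _ (fun=> 0%E)); last by move=> n _; rewrite expr0n mulr0.
      by rewrite eseries0.
  apply: le_ereal_inf_tmp => _ [U [d [_ d0' _ ->]]]; apply: nneseries_ge0 => n _ _.
  by rewrite lee_fin mulr_ge0 ?sqr_ge0// divr_ge0// pi_ge0.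
rewrite /area (_ : [set _ | _ in _] = [set 0%E]) ?ereal_sup1//.
rewrite eqEsubset; split=> [_ [d d0 <-]|_ ->]; first exact: H0.
by exists 1 => /=; [exact: ltr01|exact: H0].
Qed.

Lemma null_solution_eq0 (B S1 S2 : set 'rV[R]_3) (a rho : 'rV[R]_3 -> R)
    (k : 'rV[R]_3 -> 'M[R]_3) (tau_q tau_T : R) T q :
  regular_region B -> boundary_decomposition B S1 S2 ->
  {within closure B, continuous a} ->
  (forall x, closure B x -> (k x)^T = k x) ->
  (forall x, closure B x -> exists2 m : R, 0 < m &
    forall v : 'rV[R]_3, m * dot v v <= quadratic_form (k x) v) ->
  0 <= tau_q -> 0 <= tau_T -> tau_q = 0 \/ 0 < tau_T ->
  (forall x, closure B x -> a x <> 0) \/ S1 !=set0 ->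
  is_solution B S1 S2 a rho k tau_q tau_T (null_data (R := R)) T q ->
  forall x t, closure B x -> 0 <= t -> T x t = 0 /\ q x t = 0.
Proof.
move=> hB hS ca ksym kpos tq0 tT0 tqT aS sol x t xB t0.
have regT := sol_temp_regular sol.
have regQ i := sol_flux_regular sol i.
have [T' eT'] := temp_Dt_cont regT.
have cw j := cid (temp_Dx_cont regT j).
have cw' j := cid (temp_DtDx_cont regT j).
have cQ' i := cid (flux_Dt_cont (regQ i)).
have cQ'' i := cid (flux_Dtt_cont (regQ i)).
have cDQ i j := cid (flux_Dx_cont (regQ i) j).
have ew j := svalP (cw j); have ew' j := svalP (cw' j).
have eQ' i := svalP (cQ' i); have eQ'' i := svalP (cQ'' i).
have eDQ i j := svalP (cDQ i j).
split; last exact: (null_flux hB hS ca sol eT' ew ew' eQ' eQ'' eDQ tq0 tT0 tqT ksym kpos xB t0).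
case: aS => [a0|S0].
  exact: (null_temperature_capacity hB hS ca sol eT' ew ew' eQ' eQ'' eDQ tq0 tT0 tqT ksym kpos a0 xB t0).
exact: (null_temperature_boundary hB hS ca sol eT' ew ew' eQ' eQ'' eDQ tq0 tT0 tqT ksym kpos S0 xB t0).
Qed.
End UniquenessProof.

Theorem theorem1 (R : realType) (B S1 S2 : set 'rV[R]_3)
    (a rho : 'rV[R]_3 -> R) (k : 'rV[R]_3 -> 'M[R]_3)
    (k_m k_M : 'rV[R]_3 -> R) (tau_q tau_T : R) (D : data R)
    (hB : regular_region B)
    (hS : boundary_decomposition B S1 S2)
    (ha_cont : {within closure B, continuous a})
    (hrho_cont : {within closure B, continuous rho})
    (hk_cont : {within closure B, continuous k})
    (hk_sym : forall x, closure B x -> (k x)^T = k x)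
    (htau_q : 0 <= tau_q) (htau_T : 0 <= tau_T)
    (hD : data_regular B S1 S2 D)
    (hk_m : forall x, closure B x -> lowest_eigenvalue (k x) (k_m x))
    (hk_M : forall x, closure B x -> greatest_eigenvalue (k x) (k_M x))
    (h_i : forall x, closure B x -> 0 < k_m x /\
       forall v : 'rV[R]_3,
         k_m x * dot v v <= quadratic_form (k x) v <= k_M x * dot v v)
    (h_ii : (0 <= 2%:R^-1 * tau_q /\ 2%:R^-1 * tau_q <= tau_T) \/
            (0 < tau_T /\ tau_T < 2%:R^-1 * tau_q))
    (h_iii_iv : (forall x, closure B x -> a x <> 0) \/ area S1 <> 0%E)
    (T1 T2 : 'rV[R]_3 -> R -> R) (q1 q2 : 'rV[R]_3 -> R -> 'rV[R]_3)
    (hsol1 : is_solution B S1 S2 a rho k tau_q tau_T D T1 q1)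
    (hsol2 : is_solution B S1 S2 a rho k tau_q tau_T D T2 q2) :
  forall x t, closure B x -> 0 <= t -> T1 x t = T2 x t /\ q1 x t = q2 x t.
Proof.
have kpos x : closure B x -> exists2 m : R, 0 < m &
    forall v : 'rV[R]_3, m * dot v v <= quadratic_form (k x) v.
  by move=> /h_i [m0 mP]; exists (k_m x) => // v; have /andP[] := mP v.
have tqT : tau_q = 0 \/ 0 < tau_T.
  case: h_ii => [[_ qT]|[]]; last by right.
  move: htau_T; rewrite le_eqVlt => /predU1P[T0|]; last by right.
  by left; apply/eqP; rewrite eq_le htau_q andbT; lra.
have aS : (forall x, closure B x -> a x <> 0) \/ S1 !=set0.
  case: h_iii_iv => [|S1n0]; [by left|right].
  by apply/set0P/eqP => S10; apply: S1n0; rewrite S10; exact: area_set0.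
move=> x t xB t0.
have sol := solution_difference (region_open hB) hsol1 hsol2.
have [T0 q0] := null_solution_eq0 hB hS ha_cont hk_sym kpos htau_q htau_T tqT aS sol xB t0.
by split; apply/eqP; rewrite -subr_eq0; apply/eqP.
Qed.
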